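(* Let $R>0$, $\Pi=\{(x_1,x_2)\in\mathbb{R}^2: |x_2|\le R\}$, and let $\{s_{m,n}\}_{m,n\in\mathbb{Z}_+}$ be a sequence of complex numbers. There exists a non-negative Borel measure $\mu$ on $\Pi$ such that $$\int_\Pi x_1^m x_2^n\, d\mu = s_{m,n},\qquad m,n\in\mathbb{Z}_+,$$ if and only if for all families of complex numbers $\{\alpha_{m,n}\}_{m,n\in\mathbb{Z}_+}$ with all but finitely many $\alpha_{m,n}$ equal to zero the following two conditions hold: $$\sum_{m,n,k,l=0}^\infty \alpha_{m,n}\overline{\alpha_{k,l}}\, s_{m+k,n+l}\ \ge 0,$$ $$\sum_{m,n,k,l=0}^\infty \alpha_{m,n}\overline{\alpha_{k,l}}\,\bigl(R^2 s_{m+k,n+l}-s_{m+k,n+l+2}\bigr)\ \ge 0.$$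
   Context: $\mathbb{Z}_+$ denotes the set of non-negative integers. An inequality $c\ge 0$ for a complex number $c$ means that $c$ is real and non-negative. The condition on $\mu$ includes that all monomials $x_1^m x_2^n$ are $\mu$-integrable. *)

(* Defs.v *)
From HB Require Import structures.
From mathcomp Require Import all_boot all_order all_algebra.
From mathcomp Require Export complex.
From mathcomp Require Import all_classical all_reals all_analysis.

Set Implicit Arguments.
Unset Strict Implicit.
Unset Printing Implicit Defensive.
Import Order.TTheory GRing.Theory Num.Theory.
Import numFieldNormedType.Exports.

Local Open Scope classical_set_scope.
Local Open Scope ring_scope.
Local Open Scope complex_scope.

Definition strip (R : realType) (r : R) : set (R * R) :=
  [set x | `|x.2| <= r].

Definition monomial2 (R : realType) (m n : nat) (x : R * R) : R :=
  x.1 ^+ m * x.2 ^+ n.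

(* The measurable sets of [R * R] are those of the product sigma-algebra, which
   is the Borel sigma-algebra of the plane. Since [strip r] is closed, Borel
   measures on the strip are identified with Borel measures on the plane for
   which the complement of the strip is null. Neither [mu] nor its moments are
   assumed finite beforehand: integrability is part of the condition, as the
   real-valued integral has a junk value on non-integrable functions. *)
Definition strip_moment_measure (R : realType) (r : R)
    (s : nat -> nat -> R[i])
    (mu : {measure set (R * R)%type -> \bar R}) : Prop :=
  mu (~` strip r) = 0%E /\
  forall m n : nat,
    mu.-integrable (strip r) (fun x => (monomial2 m n x)%:E) /\
    (\int[mu]_(x in strip r) monomial2 m n x)%:C = s m n.

Definition finitely_supported2 (R : realType) (alpha : nat -> nat -> R[i]) :
    Prop :=
  finite_set [set p : nat * nat | alpha p.1 p.2 != 0].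

(* A finite sum whenever [alpha] is finitely supported: [\sum_(_ \in A)] runs
   over the indices in [A] with nonzero summand. *)
Definition moment_form (R : realType) (alpha t : nat -> nat -> R[i]) : R[i] :=
  \sum_(p \in [set: nat * nat * nat * nat])
    (let: (m, n, k, l) := p in
     alpha m n * (alpha k l)^* * t (m + k)%N (n + l)%N).

(* Main.v *)
(* Sufficiency. The first condition forces the [s m n] to be real, and turns them
   into a linear form L on R[x, y] with L(q^2) >= 0 and L((r^2 - y^2) q^2) >= 0,
   hence L((r - y)^i (r + y)^j q^2) >= 0 for all i and j. If p >= 0 on the strip,
   its Bernstein approximation in y, the combination of the (r - y)^i (r + y)^j
   whose coefficients are the values p(x, y_j) at the nodes, is mapped to a
   nonnegative number by L, since each p(x, y_j) is a sum of two squares of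
   univariate polynomials; as these approximations converge coefficientwise to
   p, L(p) >= 0. By M. Riesz's extension theorem L extends to a positive form on
   all functions dominated by a polynomial on the strip.
   Such a form, restricted to the functions on the piece n <= |x| < n + 1, is
   represented by a measure: bisect the box repeatedly, lay out the values of the
   form on the indicators of the cells as nested intervals of the real line, and
   push Lebesgue measure forward along the map sending a real number to the limit
   of the centres of the cells whose intervals contain it. The sum of these
   measures is the solution. *)
Require Import Defs.
From mathcomp Require Import all_boot all_order all_algebra.
From mathcomp Require Import all_classical all_reals all_analysis.
From mathcomp Require Import measurable_realfun polyrcf ring lra.
Import Order.TTheory GRing.Theory Num.Theory.
Import numFieldNormedType.Exports.

Local Open Scope classical_set_scope.
Local Open Scope ring_scope.
Local Open Scope complex_scope.

(** * M. Riesz's extension theorem *)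

Section RieszExtension.
Context {R : realType} {V : lmodType R} (C : V -> Prop).
Hypothesis C0 : C 0.
Hypothesis CD : forall x y, C x -> C y -> C (x + y).
Hypothesis CZ : forall a x, 0 <= a -> C x -> C (a *: x).

(** A partially defined linear form is encoded by its graph, so that extension is inclusion and
    Zorn's lemma applies to unions. Single-valuedness is a consequence of positivity: two values at
    the same vector give [(0, a - b)] and [(0, b - a)], both tested against the cone. *)
Definition positive_graph (M : set (V * R)) :=
  (forall a x y, M x -> M y -> M (a *: x.1 + y.1, a * x.2 + y.2)) /\
  (forall x, M x -> C x.1 -> 0 <= x.2).

(** With [C] read as the cone of an order, [v] lies between [- g] and [g]. *)
Definition dominated_by (G : set (V * R)) (v : V) :=
  exists2 g, G g & C (g.1 - v) /\ C (g.1 + v).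

Lemma positive_graph0 M x : positive_graph M -> M x -> M (0, 0).
Proof.
move=> [lin _] Mx; have := lin (- 1) x x Mx Mx.
by rewrite scaleN1r addNr mulN1r addNr.
Qed.

Lemma positive_graph_fun M x a b :
  positive_graph M -> M (x, a) -> M (x, b) -> a = b.
Proof.
move=> [lin pos] Ma Mb; apply/eqP; rewrite eq_le -subr_ge0 -(subr_ge0 b).
have key c d : M (x, c) -> M (x, d) -> 0 <= c - d.
  move=> Mc Md; have /= := pos _ (lin (- 1) _ _ Md Mc).
  by rewrite scaleN1r addNr mulN1r addrC; apply.
by rewrite !key.
Qed.

(** Positivity requires the new value to lie above the values of the form on vectors below [v], and
    below those on vectors above [v]. The supremum of the former does both; domination by [g] makes
    it the supremum of a nonempty bounded set. *)
Lemma positive_graph_extend (G M : set (V * R)) (v : V) :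
  positive_graph M -> G `<=` M -> dominated_by G v ->
  exists a, positive_graph [set z | exists x c, M x /\
    z = (x.1 + c *: v, x.2 + c * a)].
Proof.
move=> [lin pos] GM [g Gg [gv1 gv2]].
have Mg := GM _ Gg; have M00 := positive_graph0 M g (conj lin pos) Mg.
pose S := [set b | exists2 x, M (x, b) & C (v - x)].
have Sub b x : M x -> C (x.1 - v) -> S b -> b <= x.2.
  move=> Mx Cx [y My Cy]; have /= := pos _ (lin (- 1) _ _ My Mx).
  rewrite scaleN1r mulN1r addrC addrC [- b + _]addrC subr_ge0; apply.
  by rewrite addrC -(subrKA v); exact: CD.
have S0 : S (- g.2).
  exists (- g.1); last by rewrite opprK addrC.
  by have /= := lin (- 1) _ _ Mg M00; rewrite scaleN1r mulN1r !addr0.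
have supS : has_sup S by split; [exists (- g.2)| exists g.2 => b; exact: Sub].
exists (sup S); split.
  move=> a _ _ [x [c [Mx ->]]] [y [d [My ->]]] /=.
  exists (a *: x.1 + y.1, a * x.2 + y.2), (a * c + d); split; first exact: lin.
  congr pair; last by rewrite /=; ring.
  by rewrite /= scalerDr scalerDl scalerA addrACA.
move=> _ [x [c [Mx ->]]] /=.
have half d : M (d *: x.1, d * x.2).
  by have /= := lin d _ _ Mx M00; rewrite !addr0.
(* Dividing by [c] when it is positive shows that [- x / c] is below [v], hence contributes to [S];
   dividing by [- c] when [c] is negative shows that [- x / c] is above [v], hence bounds [S]. *)
have [->|c0|c0] : [\/ c = 0, 0 < c | c < 0].
  by have [] := ltgtP c 0; [constructor 3|constructor 2|constructor 1].
- by rewrite scale0r mul0r !addr0; exact: pos.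
- have d0 : 0 < c^-1 by rewrite invr_gt0.
  move=> /(CZ _ _ (ltW d0)); rewrite scalerDr scalerA mulVf ?gt_eqF//.
  rewrite scale1r addrC -[X in v + X]opprK -scaleNr => Cv.
  have : S (- c^-1 * x.2) by exists (- c^-1 *: x.1).
  move=> /(ub_le_sup (proj2 supS)).
  rewrite -(ler_pM2l c0) mulrA mulrN mulfV ?gt_eqF// mulN1r.
  by lra.
- have d0 : 0 < - c^-1 by rewrite oppr_gt0 invr_lt0.
  move=> /(CZ _ _ (ltW d0)); rewrite scalerDr scalerA mulNr mulVf ?lt_eqF//.
  rewrite scaleN1r => /(Sub _ _ (half _)) /= ub.
  have : sup S <= - c^-1 * x.2 by apply: ge_sup; [exists (- g.2)|exact: ub].
  rewrite -(ler_nM2l c0) mulrA mulrN mulfV ?lt_eqF// mulN1r.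
  by lra.
Qed.

Lemma maximal_positive_graph (G : set (V * R)) : positive_graph G -> G !=set0 ->
  exists M, [/\ positive_graph M, G `<=` M &
    forall v, dominated_by G v -> exists a, M (v, a)].
Proof.
move=> posG [g0 Gg0].
(* Zorn's lemma also tests the empty chain, whose union is empty; adjoining [G] in the definition of
   [P] covers that case. *)
pose P := [set A | positive_graph (A `|` G)].
have PU F : F `<=` P -> total_on F subset -> P (\bigcup_(X in F) X).
  move=> FP totF; split.
    move=> a x y Ux Uy.
    have [[A [PA AU Ax Ay]]|[Gx Gy]] : (exists A, [/\ P A,
        A `<=` \bigcup_(X in F) X, (A `|` G) x & (A `|` G) y]) \/ G x /\ G y.
      case: Ux Uy => [[X FX Xx]|Gx] [[Y FY Yy]|Gy]; last by right.
      - left; have [XY|YX] := totF _ _ FX FY.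
          exists Y; split; [exact: FP|exact: bigcup_sup|by left; exact: XY|].
          by left.
        exists X; split; [exact: FP|exact: bigcup_sup|by left|].
        by left; exact: YX.
      - by left; exists X; split;
          [exact: FP|exact: bigcup_sup|by left|by right].
      - by left; exists Y; split;
          [exact: FP|exact: bigcup_sup|by right|by left].
    + by have [/AU ?|?] := (PA.1 a _ _ Ax Ay); [left|right].
    + by right; exact: posG.1.
  move=> x [[X FX Xx]|Gx]; last exact: posG.2.
  by apply: (FP _ FX).2; left.
have [A [PA maxA]] := Zorn_bigcup PU.
exists (A `|` G); split; [exact: PA|by move=> x; right|].
move=> v dv; have [a posN] := positive_graph_extend _ _ v PA (@subsetUr _ A G) dv.
set N := [set z | _] in posN.
have MN : A `|` G `<=` N.
  by move=> [x b] Mx; exists (x, b), 0; rewrite scale0r mul0r !addr0.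
have NE : N `|` G = N by apply/seteqP; split => x; [case=> // ?; apply: MN; right|left].
have PN : P N by rewrite /P /= NE.
have AN : A `<=` N by move=> x Ax; apply: MN; left.
have {}AN : A = N by apply: contrapT => neq; apply: (maxA N) => //; split => // NA;
  apply: neq; apply/seteqP; split.
exists a; left; rewrite {1}AN; exists (0, 0), 1; rewrite /= scale1r mul1r !add0r.
by split => //; apply: (positive_graph0 (A `|` G) g0); [exact: PA|right].
Qed.

Theorem riesz_extension (G : set (V * R)) : positive_graph G -> G !=set0 ->
  exists L : V -> R,
  [/\ forall x, G x -> L x.1 = x.2,
      forall a x y, dominated_by G x -> dominated_by G y ->
        L (a *: x + y) = a * L x + L y &
      forall x, dominated_by G x -> C x -> 0 <= L x].
Proof.
move=> posG G0; have [M [posM GM Mdom]] := maximal_positive_graph _ posG G0.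
(* Outside the domain of [M] the form takes the default value 0, which is why linearity is asserted
   for dominated vectors only. *)
pose L x := xget 0 [set a | M (x, a)].
have LE x a : M (x, a) -> L x = a.
  move=> Mxa; apply: (positive_graph_fun _ _ _ _ posM _ Mxa).
  by apply: (@xgetPex _ 0 [set b | M (x, b)]); exists a.
exists L; split.
- by move=> [x a] /GM /LE.
- move=> a x y /Mdom[b Mb] /Mdom[c Mc].
  by rewrite (LE _ _ Mb) (LE _ _ Mc); apply: LE; exact: (posM.1 a _ _ Mb Mc).
- by move=> x /Mdom[b Mb]; rewrite (LE _ _ Mb); exact: (posM.2 _ Mb).
Qed.

End RieszExtension.

(** * Positivity on the strip *)

Lemma poly_ge0_right (R : rcfType) (p : {poly R}) (a : R) :
  (forall x, a < x -> 0 <= p.[x]) -> 0 <= p.[a].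
Proof.
move=> p0; rewrite leNgt; apply/negP => pa0.
have e0 : 0 < - p.[a] by rewrite oppr_gt0.
have [d d0 dp] := poly_cont a p e0.
have ad : a < a + d / 2 by lra.
have : `|a + d / 2 - a| < d by rewrite addrC addKr gtr0_norm; lra.
by move=> /dp; rewrite ltr_norml => /andP[_]; have := p0 _ ad; lra.
Qed.

Lemma poly_le0_left (R : rcfType) (p : {poly R}) (a : R) :
  (forall x, x < a -> p.[x] <= 0) -> p.[a] <= 0.
Proof.
move=> p0; have := @poly_ge0_right R (- (p \Po (- 'X))) (- a).
rewrite !(hornerN, horner_comp, hornerX) opprK oppr_ge0; apply => x ax.
by rewrite !(hornerN, horner_comp, hornerX) oppr_ge0 p0// ltrNl.
Qed.

(** The remainder of [p] modulo this quadratic has degree at most 1 and still vanishes at [z]. As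
    [z] is not real, the imaginary part kills the slope, and then the real part kills the
    constant. *)
Lemma dvdp_quadratic (R : rcfType) (p : {poly R}) (z : R[i]) :
  root (map_poly (real_complex R) p) z -> complex.Im z != 0 ->
  ('X - (complex.Re z)%:P) ^+ 2 + ((complex.Im z) ^+ 2)%:P %| p.
Proof.
case: z => a b /=; set m := (_ + _)%R => pz b0.
have mz : root (map_poly (real_complex R) m) (a +i* b).
  rewrite /m rmorphD rmorphXn /= rmorphB /= map_polyX !map_polyC /=.
  rewrite /root !hornerE /=; apply/eqP/eqP.
  by rewrite eq_complex /=; apply/andP; split; apply/eqP; ring.
have sm : size m = 3%N.
  rewrite /m size_polyDl size_exp_XsubC //.
  by rewrite (leq_ltn_trans (size_polyC_leq1 _)).
have m0 : m != 0 by rewrite -size_poly_eq0 sm.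
apply/modp_eq0P; set w := p %% m.
have sw : (size w <= 2)%N by rewrite -ltnS -sm ltn_modp.
have Ew : w = w`_1 *: 'X + (w`_0)%:P.
  apply/polyP => -[|[|i]]; rewrite coefD coefZ coefX coefC /= ?mulr0 ?mulr1 ?add0r ?addr0//.
  by rewrite nth_default// (leq_trans sw).
have : root (map_poly (real_complex R) w) (a +i* b).
  move: pz; rewrite {1}(divp_eq p m) rmorphD rmorphM /= /root hornerD hornerM.
  by rewrite (rootP mz) mulr0 add0r.
rewrite Ew rmorphD /= map_polyZ /= map_polyX map_polyC /= /root !hornerE /=.
rewrite eq_complex /= => /andP[/eqP w0 /eqP w1].
have {}w1 : w`_1 = 0.
  by apply/eqP; move: w1 => /eqP; rewrite mul0r !addr0 mulf_eq0 (negbTE b0) orbF.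
by move: w0; rewrite w1 !mul0r subrr add0r => ->; rewrite scale0r add0r polyC0.
Qed.

(** Induction on the size: a complex root splits off either the square of a real linear factor or a
    positive quadratic, itself a sum of two squares. The cofactor stays nonnegative, and sums of two
    squares are closed under products. *)
Lemma poly_ge0_sum2sqr (R : rcfType) (p : {poly R}) :
  (forall x, 0 <= p.[x]) -> exists a b : {poly R}, p = a ^+ 2 + b ^+ 2.
Proof.
move: {2}(size p) (leqnn (size p)) => n; elim: n p => [|n IH] p.
  by rewrite leqn0 size_poly_eq0 => /eqP-> _; exists 0, 0; rewrite !expr0n addr0.
move=> sp p0; have [sp1|sp1] := leqP (size p) 1.
  rewrite (size1_polyC sp1); exists (Num.sqrt p`_0)%:P, 0.
  rewrite -rmorphXn /= sqr_sqrtr ?expr0n ?addr0//.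
  by have := p0 0; rewrite horner_coef0.
have pn0 : p != 0 by rewrite -size_poly_gt0 (leq_trans _ sp1).
have /closed_rootP[[a b] pz] : size (map_poly (real_complex R) p) != 1.
  by rewrite size_map_poly gtn_eqF.
have [b0|b0] := eqVneq b 0.
  have /factor_theorem[q Eq] : root p a.
    move: pz; rewrite b0 /root -[a +i* 0]/(real_complex R a) horner_map /=.
    by rewrite -(rmorph0 (real_complex R)) (inj_eq (@complexI R)).
  (* The root is at least double: since [p] is nonnegative, the cofactor [q] is nonpositive left of
     [a] and nonnegative right of it. *)
  have : root q a.
    rewrite /root eq_le; apply/andP; split.
      apply: poly_le0_left => x xa; have := p0 x; rewrite Eq hornerM hornerXsubC.
      by rewrite nmulr_lge0// subr_lt0.
    apply: poly_ge0_right => x xa; have := p0 x; rewrite Eq hornerM hornerXsubC.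
    by rewrite pmulr_lge0// subr_gt0.
  move=> /factor_theorem[g Eg].
  have {}Eg : p = g * ('X - a%:P) ^+ 2 by rewrite Eq Eg -mulrA.
  have g0 x : 0 <= g.[x].
    have gx y : y != a -> 0 <= g.[y].
      move=> ya; have := p0 y; rewrite Eg hornerM horner_exp hornerXsubC.
      by rewrite pmulr_lge0// exprn_even_gt0//= subr_eq0.
    have [->|/gx//] := eqVneq x a.
    by apply: poly_ge0_right => y ay; apply: gx; rewrite gt_eqF.
  have [|u [v Euv]] := IH g _ g0.
    move: sp pn0; rewrite Eg mulf_eq0 negb_or => + /andP[gn0 _].
    rewrite size_Mmonic ?monic_exp ?monicXsubC// size_exp_XsubC.
    by rewrite !addnS addn0 /= ltnS => /ltnW.
  exists (u * ('X - a%:P)), (v * ('X - a%:P)).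
  by rewrite Eg Euv mulrDl !exprMn.
have /dvdpP[g Eg] := dvdp_quadratic _ _ _ pz b0; rewrite /= in Eg.
have m0 x : 0 < (x - a) ^+ 2 + b ^+ 2.
  by rewrite ltr_wpDl ?sqr_ge0// exprn_even_gt0.
have g0 x : 0 <= g.[x].
  have := p0 x; rewrite Eg !hornerE pmulr_lge0//; exact: m0.
have [|u [v Euv]] := IH g _ g0.
  move: sp pn0; rewrite Eg mulf_eq0 negb_or => + /andP[gn0 mn0].
  rewrite size_mul// size_polyDl size_exp_XsubC /=.
    by rewrite !addnS addn0 /= ltnS => /ltnW.
  by rewrite (leq_ltn_trans (size_polyC_leq1 _)).
(* The two-square identity, that is, multiplicativity of the complex modulus. *)
exists (u * ('X - a%:P) - v * b%:P), (u * b%:P + v * ('X - a%:P)).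
by rewrite Eg Euv polyC_exp; ring.
Qed.

(** * Linear forms on polynomials in two variables *)

Section LinearForm.
Context {F : comNzRingType}.

Definition linear_form (L : {poly {poly F}} -> F) :=
  forall (c : F) p q, L (c%:P%:P * p + q) = c * L p + L q.

Lemma linear_form0 L : linear_form L -> L 0 = 0.
Proof. by move=> /(_ (- 1) 0 0); rewrite mulr0 addr0 mulN1r addNr. Qed.

Lemma linear_formD L p q : linear_form L -> L (p + q) = L p + L q.
Proof. by move=> /(_ 1 p q); rewrite !polyC1 !mul1r. Qed.

Lemma linear_formZ L c p : linear_form L -> L (c%:P%:P * p) = c * L p.
Proof. by move=> lL; have := lL c p 0; rewrite !addr0 (linear_form0 _ lL) addr0. Qed.

Lemma linear_form_sum L (I : Type) (s : seq I) (P : pred I) f :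
  linear_form L -> L (\sum_(i <- s | P i) f i) = \sum_(i <- s | P i) L (f i).
Proof.
move=> lL; apply: big_morph; last exact: linear_form0.
by move=> p q; exact: linear_formD.
Qed.

(* In [{poly {poly F}}] the main variable is x2, and the coefficients are
   polynomials in x1. *)
Definition monomial_poly (m n : nat) : {poly {poly F}} := ('X^m)%:P * 'X^n.

Lemma monomial_polyM m n k l :
  monomial_poly m n * monomial_poly k l = monomial_poly (m + k) (n + l).
Proof. by rewrite /monomial_poly mulrACA -polyCM -!exprD. Qed.

Lemma poly2_ind (P : {poly {poly F}} -> Prop) : P 0 ->
  (forall c p q, P p -> P q -> P (c%:P%:P * p + q)) ->
  (forall m n, P (monomial_poly m n)) -> forall p, P p.
Proof.
move=> P0 Plin Pmon p.
have PD q1 q2 : P q1 -> P q2 -> P (q1 + q2).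
  by move=> P1 P2; have := Plin 1 _ _ P1 P2; rewrite !polyC1 mul1r.
rewrite -[p]coefK poly_def; apply: (big_ind P) => // n _.
rewrite -mul_polyC -[p`_n]coefK poly_def raddf_sum mulr_suml /=.
apply: (big_ind P) => // m _.
have -> : (p`_n`_m *: 'X^m)%:P * 'X^n = (p`_n`_m)%:P%:P * monomial_poly m n + 0.
  by rewrite addr0 -mul_polyC polyCM -mulrA.
exact: Plin.
Qed.

Lemma linear_form_eq L1 L2 : linear_form L1 -> linear_form L2 ->
  (forall m n, L1 (monomial_poly m n) = L2 (monomial_poly m n)) -> L1 =1 L2.
Proof.
move=> l1 l2 eq12; apply: poly2_ind => // [|c p q Ep Eq].
  by rewrite !linear_form0.
by rewrite l1 l2 Ep Eq.
Qed.

(** The Riesz functional of the sequence [t]. *)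
Definition moment_functional (t : nat -> nat -> F) (p : {poly {poly F}}) : F :=
  \sum_(n < size p) \sum_(m < size p`_n) p`_n`_m * t m n.

Lemma sum_coef_widen (A : nzRingType) (g : nat -> A -> F) N (p : {poly A}) :
  (forall n, g n 0 = 0) -> (size p <= N)%N ->
  \sum_(n < size p) g n p`_n = \sum_(n < N) g n p`_n.
Proof.
move=> g0 pN; rewrite (big_ord_widen N (fun n => g n p`_n))//.
rewrite [RHS](bigID (fun n : 'I_N => (n < size p)%N))/= [X in _ + X]big1 ?addr0//.
by move=> n; rewrite -leqNgt => pn; rewrite nth_default.
Qed.

(** The three sums have ranges depending on three sizes; widening all of them to a common bound
    makes linearity termwise. The general [g] serves both levels of coefficients, those in x2 and
    those in x1. *)
Lemma sum_coef_lin (A : nzRingType) (g : nat -> A -> F) c a (p q : {poly A}) :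
  (forall n x y, g n (a * x + y) = c * g n x + g n y) ->
  (forall n, g n 0 = 0) ->
  \sum_(n < size (a%:P * p + q)) g n (a%:P * p + q)`_n =
  c * (\sum_(n < size p) g n p`_n) + \sum_(n < size q) g n q`_n.
Proof.
move=> glin g0; pose N := maxn (size (a%:P * p + q)) (maxn (size p) (size q)).
rewrite !(@sum_coef_widen _ g N)//; first last.
- by rewrite leq_maxl.
- by rewrite /N maxnA leq_max leq_max leqnn orbT.
- by rewrite /N maxnA leq_max leqnn orbT.
rewrite mulr_sumr -big_split; apply: eq_bigr => n _.
by rewrite coefD coefCM glin.
Qed.

Lemma linear_moment_functional t : linear_form (moment_functional t).
Proof.
move=> c p q.
pose g n (x : {poly F}) := \sum_(m < size x) x`_m * t m n.
apply: (sum_coef_lin _ g) => n; last by rewrite /g size_poly0 big_ord0.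
move=> x y; apply: (sum_coef_lin _ (fun m z => z * t m n)) => m; last exact: mul0r.
by move=> z w; rewrite mulrDl mulrA.
Qed.

Lemma moment_functional_monomial t m n :
  moment_functional t (monomial_poly m n) = t m n.
Proof.
have E k : (monomial_poly m n)`_k = if k == n then 'X^m else 0.
  by rewrite /monomial_poly coefCM coefXn; case: eqP; rewrite ?mulr1 ?mulr0.
pose g k (x : {poly F}) := \sum_(l < size x) x`_l * t l k.
rewrite /moment_functional (@sum_coef_widen _ g n.+1); last 2 first.
- by move=> k; rewrite /g size_poly0 big_ord0.
- by apply/leq_sizeP => k nk; rewrite E gtn_eqF.
rewrite big_ord_recr big1 /= => [|k _]; last first.
  by rewrite E ltn_eqF// /g size_poly0 big_ord0.
rewrite add0r E eqxx /g size_polyXn big_ord_recr big1 /= => [|l _].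
  by rewrite add0r coefXn eqxx mul1r.
by rewrite coefXn ltn_eqF// mul0r.
Qed.

End LinearForm.

(** * Bernstein approximation in x2 and positivity of forms *)

Section StripPositivity.
Context {R : realType} (r : R) (r0 : 0 < r).
Local Notation RXY := {poly {poly R}}.

Let rP : RXY := r%:P%:P.

(** The point j/N of [0, 1], carried to [-r, r] by the increasing affine map. *)
Definition bernstein_node (N j : nat) : R := r * (2 * j%:R - N%:R) / N%:R.

Definition bernstein_basis (N j : nat) : RXY :=
  (rP - 'X) ^+ (N - j) * (rP + 'X) ^+ j.

(** The Bernstein operator of [-r, r] in the variable x2, without its normalising factor
    [(2 * r) ^- N]; the values at the nodes are polynomials in x1. *)
Definition bernstein_sum (N : nat) (p : RXY) : RXY :=
  \sum_(j < N.+1) (bernstein_basis N j *+ 'C(N, j)) *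
    (p.[(bernstein_node N j)%:P])%:P.

Lemma bernstein_sumC N c : bernstein_sum N c%:P = ((2 * r) ^+ N)%:P%:P * c%:P.
Proof.
rewrite /bernstein_sum; under eq_bigr do rewrite hornerC.
rewrite -mulr_suml -exprDn addrACA addNr addr0 -!rmorphD /=.
by rewrite -mulr2n mulr_natl !polyC_exp.
Qed.

Lemma bernstein_sumD N p q :
  bernstein_sum N (p + q) = bernstein_sum N p + bernstein_sum N q.
Proof.
by rewrite -big_split; apply: eq_bigr => j _; rewrite hornerD polyCD mulrDr.
Qed.

(** The logarithmic derivative of the basis element is j/(r + y) - (N - j)/(r - y); multiplying by
    r^2 - y^2 clears the denominators. *)
Lemma deriv_bernstein_basis N j : (j <= N)%N ->
  (rP ^+ 2 - 'X ^+ 2) * (bernstein_basis N j)^`() =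
  (((r * (2 * j%:R - N%:R))%:P)%:P - N%:R * 'X) * bernstein_basis N j.
Proof.
move=> jN.
(* This includes k = 0, where the truncated exponent is harmless because of the factor k. *)
have key (A : RXY) k : A * (A ^+ k.-1 *+ k) = A ^+ k * k%:R.
  by case: k => [|k]; rewrite ?mulr0n ?mulr0// mulrnAr -exprS mulr_natr.
rewrite /bernstein_basis derivM !deriv_exp !derivD derivN derivX.
rewrite /rP derivC -/rP !add0r.
set A := rP + 'X; set B := rP - 'X.
rewrite mulN1r mulNrn mul1r.
have := key A j; have := key B (N - j)%N.
set U := A ^+ j.-1 *+ j; set V := B ^+ (N - j).-1 *+ (N - j) => HV HU.
have expand (S : comNzRingType) (a x u v w z : S) :
    (a ^+ 2 - x ^+ 2) * (- v * w + z * u) =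
    (a - x) * z * ((a + x) * u) - (a + x) * w * ((a - x) * v) by ring.
have -> : (r * (2 * j%:R - N%:R))%:P%:P = rP * (j%:R - (N - j)%:R) :> RXY.
  rewrite mulr_natl mulr2n natrB // opprB addrA.
  by rewrite !(rmorphM, rmorphB, rmorphD) /= !polyC_natr.
rewrite expand HV HU natrB// /A /B.
have collect (S : comNzRingType) (a x m n w z : S) :
    (a - x) * z * (w * m) - (a + x) * w * (z * (n - m)) =
    (a * (m - (n - m)) - n * x) * (z * w) by ring.
exact: collect.
Qed.

(** Multiplying [p] by the variable multiplies each summand by its node, and by
    [deriv_bernstein_basis] N times (node minus y) acts on a basis element as (r^2 - y^2) d/dy. *)
Lemma bernstein_sumX N p : (0 < N)%N ->
  N%:R * bernstein_sum N (p * 'X) =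
  N%:R * 'X * bernstein_sum N p
  + (rP ^+ 2 - 'X ^+ 2) * (bernstein_sum N p)^`().
Proof.
move=> N0; rewrite /bernstein_sum raddf_sum !mulr_sumr -big_split /=.
apply: eq_bigr => j _; rewrite hornerM hornerX polyCM derivM derivC mulr0 addr0.
have jN : (j <= N)%N by rewrite -ltnS.
rewrite derivMn -[bernstein_basis N j *+ _]mulr_natr -[_^`() *+ _]mulr_natr.
set g := bernstein_basis N j; set h := (p.[_])%:P.
have -> : (rP ^+ 2 - 'X ^+ 2) * (g^`() * 'C(N, j)%:R * h) =
  (rP ^+ 2 - 'X ^+ 2) * g^`() * 'C(N, j)%:R * h by rewrite !mulrA.
rewrite deriv_bernstein_basis//.
have -> : (r * (2 * j%:R - N%:R))%:P%:P =
    N%:R * (bernstein_node N j)%:P%:P :> RXY.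
  have -> : N%:R = N%:R%:P%:P :> RXY by rewrite !polyC_natr.
  rewrite -!polyCM /bernstein_node mulrCA divff ?mulr1// pnatr_eq0.
  by rewrite -lt0n.
have E (S : comNzRingType) (n u b v y x : S) :
  n * (u * b * (v * y)) = n * x * (u * b * v) + (n * y - n * x) * u * b * v
  by ring.
exact: E.
Qed.

(** Induction on [p] with [L] general. By [bernstein_sumX], the value of [L] at the sum for [p * 'X]
    is that of [L1] at the sum for [p], plus 1/N times that of [L2]. Both forms are linear, so the
    induction hypothesis applies to each, and the second term tends to 0. *)
Lemma bernstein_sum_cvg p L : linear_form L ->
  (2 * r) ^- n.+1 * L (bernstein_sum n.+1 p) @[n --> \oo] --> L p.
Proof.
elim/poly_ind: p L => [|p c IH] L lL.
  rewrite linear_form0//.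
  under eq_cvg => n.
    rewrite -polyC0 bernstein_sumC linear_formZ// polyC0 linear_form0// !mulr0.
    over.
  exact: cvg_cst.
pose L1 q := L ('X * q).
pose L2 q := L ((rP ^+ 2 - 'X ^+ 2) * q^`()).
have lL1 : linear_form L1.
  by move=> a q1 q2; rewrite /L1 mulrDr mulrCA lL.
have lL2 : linear_form L2.
  move=> a q1 q2; rewrite /L2 derivD derivM derivC mul0r add0r mulrDr mulrCA.
  exact: lL.
rewrite (linear_formD L)//.
under eq_cvg => n.
  rewrite bernstein_sumD linear_formD// bernstein_sumC linear_formZ// mulrDr.
  rewrite mulKf ?expf_neq0 ?mulf_neq0 ?gt_eqF//.
  have -> : L (bernstein_sum n.+1 (p * 'X)) =
      L1 (bernstein_sum n.+1 p) + n.+1%:R^-1 * L2 (bernstein_sum n.+1 p).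
    have n0 : n.+1%:R != 0 :> R by rewrite pnatr_eq0.
    apply: (mulfI n0); rewrite mulrDr mulVKf// /L1 /L2.
    rewrite -!(linear_formZ L)// -(linear_formD L)//.
    by rewrite !polyC_natr bernstein_sumX// mulrA.
  rewrite mulrDr mulrCA.
  over.
have -> : L (p * 'X) + L c%:P = L1 p + 0 * L2 p + L c%:P.
  by rewrite mul0r addr0 /L1 mulrC.
apply: cvgD; last exact: cvg_cst.
apply: cvgD; first exact: IH.
by apply: cvgM; [exact: cvg_harmonic|exact: IH].
Qed.

Context (L : RXY -> R) (linL : linear_form L)
  (Lsqr : forall q, 0 <= L (q ^+ 2))
  (Lstrip : forall q, 0 <= L ((rP ^+ 2 - 'X ^+ 2) * q ^+ 2)).

(** Even powers are absorbed into the square, leaving exponents 0 or 1. Two zeros give [Lsqr], two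
    ones give [Lstrip], and a single factor is reduced to both. *)
Lemma strip_form_basis_ge0 i j q :
  0 <= L ((rP - 'X) ^+ i * (rP + 'X) ^+ j * q ^+ 2).
Proof.
have odd_even k (A : RXY) :
    exists (b : bool) h, A ^+ k = A ^+ b * h ^+ 2.
  exists (odd k), (A ^+ k./2); rewrite -exprM -exprD muln2.
  by rewrite odd_double_half.
have [b [A ->]] := odd_even i (rP - 'X).
have [c [B ->]] := odd_even j (rP + 'X).
have -> : (rP - 'X) ^+ b * A ^+ 2 * ((rP + 'X) ^+ c * B ^+ 2) * q ^+ 2 =
  (rP - 'X) ^+ b * (rP + 'X) ^+ c * (A * B * q) ^+ 2.
  have E (S : comNzRingType) (x y u v w : S) :
    x * u ^+ 2 * (y * v ^+ 2) * w ^+ 2 = x * y * (u * v * w) ^+ 2 by ring.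
  exact: E.
move: (A * B * q) => {A B}q.
have scale p : 0 <= L ((2 * r)%:P%:P * p) -> 0 <= L p.
  by rewrite linear_formZ// pmulr_rge0// mulr_gt0.
have r2 : (2 * r)%:P%:P = rP + rP :> RXY by rewrite -!rmorphD /= -mulr2n mulr_natl.
(* 2 r (r + y) = (r + y)^2 + (r^2 - y^2), and likewise for r - y *)
have expand (S : comNzRingType) (s x u : S) :
  (s + s) * ((s + x) * u ^+ 2) =
    ((s + x) * u) ^+ 2 + (s ^+ 2 - x ^+ 2) * u ^+ 2 by ring.
case: b c => -[]; rewrite ?expr1 ?expr0 ?mul1r ?mulr1.
- by rewrite -subr_sqr.
- apply: scale; rewrite r2 expand linear_formD//.
  by rewrite sqrrN addr_ge0.
- by apply: scale; rewrite r2 expand linear_formD// addr_ge0.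
- exact: Lsqr.
Qed.

Theorem strip_form_ge0 p :
  (forall x y, `|y| <= r -> 0 <= p.[y%:P].[x]) -> 0 <= L p.
Proof.
move=> p0; apply: (cvgr_to_ge (bernstein_sum_cvg p L linL)).
near=> n.
rewrite pmulr_rge0; last by rewrite invr_gt0 exprn_gt0// mulr_gt0.
rewrite /bernstein_sum linear_form_sum//; apply: sumr_ge0 => j _.
have [a [b ->]] : exists a b, p.[(bernstein_node n.+1 j)%:P] = a ^+ 2 + b ^+ 2.
  apply: poly_ge0_sum2sqr => x; apply: p0.
  have jn : (j <= n.+1)%N by rewrite -ltnS.
  have n0 : 0 < n.+1%:R :> R by rewrite ltr0n.
  have jn' : j%:R <= n.+1%:R :> R by rewrite ler_nat.
  rewrite /bernstein_node !normrM normfV (gtr0_norm r0) (gtr0_norm n0).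
  rewrite ler_pdivrMr// ler_pM2l// ler_norml.
  by have : 0 <= j%:R :> R by []; lra.
have -> : bernstein_basis n.+1 j *+ 'C(n.+1, j) =
    ('C(n.+1, j)%:R)%:P%:P * bernstein_basis n.+1 j.
  by rewrite !polyC_natr mulr_natl.
rewrite -mulrA linear_formZ// mulr_ge0// polyCD !polyC_exp mulrDr linear_formD//.
by rewrite addr_ge0// /bernstein_basis strip_form_basis_ge0.
Unshelve. all: by end_near. Qed.

End StripPositivity.
(** * Representation of positive forms on bounded functions *)

Definition fbounded {R : realType} {T : Type} (f : T -> R) :=
  exists C, forall x, `|f x| <= C.

Section BoundedRepresentation.
Context {R : realType} {T : Type} (Phi : (T -> R) -> R).
Hypothesis Phi_lin : forall a f g, fbounded f -> fbounded g ->
  Phi (fun x => a * f x + g x) = a * Phi f + Phi g.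
Hypothesis Phi_ge0 : forall f, fbounded f -> (forall x, 0 <= f x) -> 0 <= Phi f.

Lemma fbounded_cst (c : R) : fbounded (fun _ : T => c).
Proof. by exists `|c|. Qed.

Lemma fbounded_lin a (f g : T -> R) : fbounded f -> fbounded g ->
  fbounded (fun x => a * f x + g x).
Proof.
move=> [C fC] [D gD]; exists (`|a| * C + D) => x.
by rewrite (le_trans (ler_normD _ _))// lerD// normrM ler_wpM2l.
Qed.

Lemma PhiZ a f : fbounded f -> Phi (fun x => a * f x) = a * Phi f.
Proof.
move=> bf; have P0 : Phi (fun=> 0) = 0.
  have := Phi_lin (- 1) _ _ (fbounded_cst 0) (fbounded_cst 0).
  by rewrite mulr0 addr0 mulN1r addNr.
have := Phi_lin a _ _ bf (fbounded_cst 0); rewrite P0 addr0 => <-.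
by congr Phi; apply/funext => x; rewrite addr0.
Qed.

Lemma PhiD f g : fbounded f -> fbounded g ->
  Phi (fun x => f x + g x) = Phi f + Phi g.
Proof.
move=> bf bg; rewrite -[X in X + _]mul1r -Phi_lin//.
by congr Phi; apply/funext => x; rewrite mul1r.
Qed.

Lemma Phi_dist_le f g e : fbounded f -> fbounded g ->
  (forall x, `|f x - g x| <= e) -> `|Phi f - Phi g| <= e * Phi (fun=> 1).
Proof.
move=> bf bg fg; have b1 := fbounded_cst 1.
rewrite -PhiZ//; have be : fbounded (fun=> e * 1 : R) := fbounded_cst _.
have bfg := fbounded_lin (- 1) _ _ bg bf.
have Ed : Phi f - Phi g = Phi (fun x => - 1 * g x + f x).
  by rewrite Phi_lin// mulN1r addrC.
rewrite Ed ler_norml; apply/andP; split; rewrite -subr_ge0.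
- rewrite opprK addrC -PhiD//; apply: Phi_ge0 => [|x].
    by have := fbounded_lin 1 _ _ be bfg; under eq_fun do rewrite mul1r.
  by have := fg x; rewrite ler_norml => /andP[]; lra.
- rewrite -[- Phi _]mulN1r addrC -Phi_lin//; apply: Phi_ge0 => [|x].
    exact: fbounded_lin.
  by have := fg x; rewrite ler_norml => /andP[]; lra.
Qed.

Context (u : bool -> T -> R) (h : bool -> R).
Hypothesis h_ge0 : forall i, 0 <= h i.
Hypothesis u_le : forall i x, `|u i x| <= h i.

(* A word is read from its end: its n-th letter from the end records in which
   half of the current box the point lies, the two coordinates being bisected
   alternately. *)
Fixpoint rad (n : nat) (i : bool) : R :=
  if n is n'.+1 then
    if odd n' == i then rad n' i / 2 else rad n' i
  else h i.

Fixpoint centre (w : seq bool) (i : bool) : R :=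
  if w is b :: w' then
    if odd (size w') == i then
      centre w' i + (if b then rad (size w') i / 2 else - (rad (size w') i / 2))
    else centre w' i
  else 0.

Fixpoint word (n : nat) (x : T) : seq bool :=
  if n is n'.+1 then
    (centre (word n' x) (odd n') <= u (odd n') x) :: word n' x
  else [::].

Definition cell (w : seq bool) (x : T) : R := (word (size w) x == w)%:R.

Definition weight (w : seq bool) : R := Phi (cell w).

(** The interval of [true :: w] starts where that of [false :: w] ends, so that the two halves of a
    cell tile the interval of the cell. *)
Fixpoint left_end (w : seq bool) : R :=
  if w is b :: w' then
    left_end w' + (if b then weight (false :: w') else 0)
  else 0.

Definition cell_itv (w : seq bool) : set R :=
  `[left_end w, left_end w + weight w[%classic.

(** The counterpart of [word] on the real line. It yields a word for every real number, even outside
    the root interval, so that limit points lie in the box everywhere. *)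
Fixpoint code (n : nat) (t : R) : seq bool :=
  if n is n'.+1 then
    (left_end (code n' t) + weight (false :: code n' t) <= t) :: code n' t
  else [::].

Lemma size_word n x : size (word n x) = n.
Proof. by elim: n => //= n ->. Qed.

Lemma size_code n t : size (code n t) = n.
Proof. by elim: n => //= n ->. Qed.

Lemma rad_ge0 n i : 0 <= rad n i.
Proof. by elim: n => //= n IH; case: ifP => // _; rewrite divr_ge0. Qed.

(** Two consecutive steps bisect each coordinate exactly once; even indices thus treat both
    coordinates alike, and limits are taken along them. *)
Lemma rad_double k i : rad k.*2 i = h i / 2 ^+ k.
Proof.
elim: k => [|k]; first by rewrite expr0 divr1.
rewrite doubleS exprS invfM [2^-1 * _]mulrC mulrA => <- /=.
by rewrite odd_double; case: i.
Qed.

Lemma word_centre n i x : `|u i x - centre (word n x) i| <= rad n i.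
Proof.
elim: n => [|n] /=; first by rewrite subr0.
rewrite size_word; case: eqP => [->|_]//; rewrite !ler_norml => /andP[].
by case: ifP => [|/negbT]; rewrite -?ltNge => *; apply/andP; split; lra.
Qed.

Lemma centre_step b w i : `|centre (b :: w) i - centre w i| <=
  rad (size w) i - rad (size w).+1 i.
Proof.
rewrite /=; case: ifP => _; last by rewrite !subrr normr0.
have := rad_ge0 (size w) i; rewrite ler_norml.
by case: b => ?; apply/andP; split; lra.
Qed.

Lemma centre_le w i : `|centre w i| <= h i.
Proof.
suff : `|centre w i| <= h i - rad (size w) i.
  by move=> /le_trans; apply; rewrite gerBl rad_ge0.
elim: w => [|b w IH]; first by rewrite /= normr0 subrr.
have := centre_step b w i; rewrite -[size (b :: w)]/(size w).+1.
by move: IH; rewrite !ler_norml => /andP[? ?] /andP[? ?]; apply/andP; split; lra.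
Qed.

Lemma cell_le1 w x : `|cell w x| <= 1.
Proof. by rewrite /cell; case: eqP; rewrite ?normr1 ?normr0. Qed.

Lemma cell_split w x : cell w x = cell (false :: w) x + cell (true :: w) x.
Proof.
rewrite /cell /= !eqseq_cons; case: (word _ x =P w) => _ /=.
  by case: (_ <= _); rewrite ?addr0 ?add0r.
by rewrite !andbF addr0.
Qed.

Lemma weight_ge0 w : 0 <= weight w.
Proof. by apply: Phi_ge0 => //; exists 1; exact: cell_le1. Qed.

Lemma weight_split w : weight w = weight (false :: w) + weight (true :: w).
Proof.
rewrite /weight -PhiD; [|by exists 1; exact: cell_le1..].
by congr Phi; apply/funext => x; exact: cell_split.
Qed.

Lemma cell_itv_split w :
  cell_itv w = cell_itv (false :: w) `|` cell_itv (true :: w).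
Proof.
have w0 := weight_ge0 (false :: w); have w1 := weight_ge0 (true :: w).
have ws := weight_split w.
apply/seteqP; split => t; rewrite /cell_itv /= !in_itv /= addr0.
  move=> /andP[t0 t1].
  have [tw|wt] := ltP t (left_end w + weight (false :: w)).
    by left; rewrite t0.
  by right; apply/andP; split; lra.
by case=> /andP[t0 t1]; apply/andP; split; lra.
Qed.

Lemma cell_itv_disjoint w :
  [disjoint cell_itv (false :: w) & cell_itv (true :: w)].
Proof.
apply/disj_setPS => t [] /=; rewrite /cell_itv /= !in_itv /= addr0.
by move=> /andP[_ t1] /andP[t2 _]; lra.
Qed.

Lemma code_cell_itv w t : cell_itv w t -> code (size w) t = w.
Proof.
elim: w => [//|b w IH] tw.
have /IH Ew : cell_itv w t.
  by rewrite cell_itv_split; case: b tw => ?; [right|left].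
rewrite /= Ew; congr cons; move: tw; rewrite /cell_itv /= in_itv /=.
by case: b => /andP[t0 t1]; [|apply/negbTE; rewrite -ltNge]; lra.
Qed.

Lemma measurable_code (G : seq bool -> R) n :
  measurable_fun [set: measurableTypeR R] (fun t => G (code n t)).
Proof.
elim: n G => [|n IH] G /=; first exact: measurable_cst.
rewrite (_ : (fun t => _) = fun t =>
    if left_end (code n t) + weight (false :: code n t) <= t
    then G (true :: code n t) else G (false :: code n t)); last first.
  by apply/funext => t /=; case: ifP.
apply: measurable_fun_ifT.
- apply: measurable_fun_ler; last exact: measurable_id.
  exact: (IH (fun w => left_end w + weight (false :: w))).
- exact: (IH (fun w => G (true :: w))).
- exact: (IH (fun w => G (false :: w))).
Qed.

Notation leb := (@lebesgue_measure R).

Lemma measurable_cell_itv w : measurable (cell_itv w : set (measurableTypeR R)).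
Proof. exact: measurable_itv. Qed.

Lemma lebesgue_cell_itv w : leb (cell_itv w) = (weight w)%:E.
Proof.
rewrite /cell_itv lebesgue_measure_itv /= lte_fin ltrDl.
have := weight_ge0 w; rewrite le_eqVlt => /predU1P[<-|->]; first by rewrite ltxx.
by rewrite -EFinB addrAC subrr add0r.
Qed.

Lemma bounded_integrable d (X : measurableType d)
    (mu : {measure set X -> \bar R}) (A : set X) (f : X -> R) M :
  measurable A -> (mu A < +oo)%E -> measurable_fun A f ->
  (forall x, A x -> `|f x| <= M) -> mu.-integrable A (EFin \o f).
Proof.
move=> mA muA mf fM; apply: measurable_bounded_integrable => //.
exists M; split; first exact: num_real.
by move=> N MN x Ax; exact: le_trans (fM _ Ax) (ltW MN).
Qed.

(** Both sides are additive when [w] is split into its two halves, which gives the induction on [n].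
    For n = 0 both functions are the constant [G w] on the cell or interval of [w], whose size is
    [weight w] on either side. *)
Lemma integral_code (G : seq bool -> R) C n w : (forall v, `|G v| <= C) ->
  \int[leb]_(t in cell_itv w) G (code (n + size w) t) =
  Phi (fun x => cell w x * G (word (n + size w) x)).
Proof.
move=> GC; elim: n w => [|n IH] w.
  rewrite add0n (@eq_Rintegral _ _ _ leb (cell_itv w) (fun=> G w)); last first.
    by move=> t; rewrite inE => /code_cell_itv ->.
  rewrite Rintegral_cst; last exact: measurable_cell_itv.
  rewrite [X in fine X]lebesgue_cell_itv /= -PhiZ; last by exists 1; exact: cell_le1.
  congr Phi; apply/funext => x; rewrite mulrC /cell.
  by case: eqP => [->|]; rewrite ?mul0r.
rewrite cell_itv_split Rintegral_setU; last first.
- exact: cell_itv_disjoint.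
- rewrite -cell_itv_split; apply: (@bounded_integrable _ _ _ _ _ C) => //.
  + exact: measurable_cell_itv.
  + by rewrite [X in (X < _)%E]lebesgue_cell_itv ltry.
  + by apply: measurable_funTS; exact: measurable_code.
- exact: measurable_cell_itv.
- exact: measurable_cell_itv.
have := IH (false :: w); have := IH (true :: w); rewrite /= addnS -addSn => -> ->.
have bnd b : fbounded (fun x => cell (b :: w) x * G (word (n.+1 + size w) x)).
  by exists (1 * C) => x; rewrite normrM ler_pM// cell_le1.
rewrite -PhiD//; congr Phi; apply/funext => x.
by rewrite -mulrDl -cell_split.
Qed.

(* The lower bounds of the nested intervals increase to the common limit of the
   centres. *)
Definition limit_point (i : bool) (t : R) : R :=
  sup (range (fun n => centre (code n t) i - rad n i)).

(** Nested intervals: by [centre_step] the centre moves by at most the decrease of the radius, so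
    the lower ends [lo] increase, the upper ends [hi] decrease, and every [lo] is below every
    [hi]. *)
Lemma limit_point_code n i t :
  `|limit_point i t - centre (code n t) i| <= rad n i.
Proof.
pose lo n := centre (code n t) i - rad n i.
pose hi n := centre (code n t) i + rad n i.
have step k := centre_step (left_end (code k t) + weight (false :: code k t) <= t)
  (code k t) i.
have los : {homo lo : m n / (m <= n)%N >-> m <= n}.
  apply/nondecreasing_seqP => k; rewrite /lo.
  by have := step k; rewrite size_code ler_norml => /andP[]; rewrite /=; lra.
have his : {homo hi : m n / (m <= n)%N >-> n <= m}.
  apply/nonincreasing_seqP => k; rewrite /hi.
  by have := step k; rewrite size_code ler_norml => /andP[]; rewrite /=; lra.
have lohi m k : lo m <= hi k.
  apply: (le_trans (los _ _ (leq_maxl m k))).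
  apply: (le_trans _ (his _ _ (leq_maxr m k))).
  by rewrite /lo /hi; have := rad_ge0 (maxn m k) i; lra.
have ub k : ubound (range lo) (hi k) by move=> _ [m _ <-].
have : limit_point i t <= hi n by apply: ge_sup => //; exists (lo 0%N), 0%N.
have : lo n <= limit_point i t.
  by apply: ub_le_sup; [exists (hi 0%N)|exists n].
by rewrite /lo /hi ler_norml => ? ?; apply/andP; split; lra.
Qed.

Lemma cvg_rad_double i : rad k.*2 i @[k --> \oo] --> 0.
Proof.
under eq_fun do rewrite rad_double -exprVn.
by apply: cvg_geometric; rewrite ger0_norm ?invr_ge0// invf_lt1// ltr1n.
Qed.

Lemma limit_point_le i t : `|limit_point i t| <= h i.
Proof.
suff : `|limit_point i t| - h i <= 0 by rewrite subr_le0.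
apply: (cvgr_to_ge (cvg_rad_double i)); near=> k.
have := limit_point_code k.*2 i t; have := centre_le (code k.*2 t) i.
have := ler_normD (limit_point i t - centre (code k.*2 t) i) (centre (code k.*2 t) i).
by rewrite subrK; lra.
Unshelve. all: by end_near. Qed.

Lemma measurable_limit_point i :
  measurable_fun [set: measurableTypeR R] (limit_point i : _ -> measurableTypeR R).
Proof.
apply: (@measurable_fun_cvg _ _ _ _
  (fun k (t : measurableTypeR R) => centre (code k.*2 t) i)) => [k|t _].
  exact: (measurable_code (fun w => centre w i)).
apply/cvgrPdist_le => e e0; near=> k.
rewrite (le_trans (limit_point_code _ _ _))//.
rewrite -[X in X <= _]ger0_norm ?rad_ge0// -[X in `|X|]subr0 distrC.
near: k; exact: (cvgrPdist_le _ _).1 (cvg_rad_double i) _ e0.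
Unshelve. all: by end_near. Qed.


Definition representing_point (t : measurableTypeR R) : R * R :=
  (limit_point false t, limit_point true t).

Lemma measurable_representing_point :
  measurable_fun [set: measurableTypeR R] representing_point.
Proof.
by apply: measurable_fun_pair; exact: measurable_limit_point.
Qed.

Definition representing_measure : {measure set (R * R)%type -> \bar R}.
Proof.
refine (pushforward (mrestr leb (measurable_cell_itv [::])) representing_point).
exact: measurable_representing_point.
Defined.

Definition box : set (R * R) := [set p | `|p.1| <= h false /\ `|p.2| <= h true].

Lemma box_representing_point t : box (representing_point t).
Proof. by split; exact: limit_point_le. Qed.

Lemma representing_measure_box : representing_measure (~` box) = 0%E.
Proof.
rewrite /representing_measure /= /pushforward (_ : _ @^-1` _ = set0) ?measure0//.
by apply/seteqP; split => // t /(_ (box_representing_point t)).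
Qed.

(** Both sides are compared with the integral of [f] at the centres of the n-th cells, which
    [integral_code] also expresses through [Phi]. The Lipschitz bound controls both errors by the
    size of the cells. *)
Lemma integral_representing_measure (D : set (R * R)) (f : R * R -> R) K :
  0 <= K -> measurable D -> measurable_fun setT f -> box `<=` D ->
  (forall p q, box p -> box q ->
    `|f p - f q| <= K * (`|p.1 - q.1| + `|p.2 - q.2|)) ->
  representing_measure.-integrable D (EFin \o f) /\
  \int[representing_measure]_(x in D) f x =
    Phi (fun x => f (u false x, u true x)).
Proof.
move=> K0 mD mf boxD lipf.
have box0 : box (0, 0) by rewrite /box /= normr0.
pose C := K * (h false + h true) + `|f (0, 0)|.
have fC p : box p -> `|f p| <= C.
  move=> bp; have := lipf _ _ bp box0; rewrite /= !subr0 => lip.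
  rewrite -[f p](subrK (f (0, 0))) (le_trans (ler_normD _ _))// lerD2r.
  by rewrite (le_trans lip)// ler_wpM2l// lerD; case: bp.
pose m0 : {measure set _ -> \bar R} := mrestr leb (measurable_cell_itv [::]).
have mfp : measurable_fun [set: measurableTypeR R] (f \o representing_point).
  by apply: measurableT_comp => //; exact: measurable_representing_point.
have fpC t : `|(f \o representing_point) t| <= C.
  by apply: fC; exact: box_representing_point.
have leb0 : leb (cell_itv [::]) = (weight [::])%:E by exact: lebesgue_cell_itv.
have int0 : m0.-integrable setT (EFin \o (f \o representing_point)).
  apply: (@bounded_integrable _ _ _ _ _ C) => //.
  by rewrite /m0 /= /mrestr setTI leb0 ltry.
have preD : representing_point @^-1` D = setT.
  by apply/seteqP; split => // t _; apply: boxD; exact: box_representing_point.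
have mEf : measurable_fun [set: R * R] (EFin \o f) by exact/measurable_EFinP.
have intD : m0.-integrable (representing_point @^-1` D)
    ((EFin \o f) \o representing_point) by rewrite preD.
split.
  exact: (integrable_pushforward measurable_representing_point mEf intD).
rewrite /Rintegral (integral_pushforward measurable_representing_point mEf intD)//.
(* The complement of the root interval is null for [m0], and on the root interval [m0] agrees with
   Lebesgue measure. *)
rewrite preD (@negligible_integral _ _ _ m0 _ (~` cell_itv [::]))//; last 2 first.
- exact: measurableC (measurable_cell_itv _).
- by rewrite /m0 /= /mrestr setICl measure0.
rewrite setTD setCK (@eq_measure_integral _ _ _ _ leb); last first.
  by move=> A mA AI; rewrite /m0 /= /mrestr setIidl.
rewrite -/(Rintegral _ _ (f \o representing_point)).
set X := Rintegral _ _ _; set Y := Phi _.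
pose fc w := f (centre w false, centre w true).
have fcC w : `|fc w| <= C by apply: fC; split; exact: centre_le.
(* A bound for the distance of [f] from its value at the centre of an n-th cell, times the total
   mass [weight [::]]. *)
pose e n := K * (rad n false + rad n true) * weight [::].
have leY n : `|Y - \int[leb]_(t in cell_itv [::]) fc (code n t)| <= e n.
  have := integral_code fc C n [::] fcC; rewrite /= addn0 => ->.
  apply: Phi_dist_le => [||x].
  - by exists C => x; apply: fC; split; exact: u_le.
  - by exists C => x; rewrite /cell eqxx mul1r.
  rewrite /cell eqxx mul1r (le_trans (lipf _ _ _ _))//.
  - by split; exact: u_le.
  - by split; exact: centre_le.
  by rewrite ler_wpM2l// lerD// word_centre.
have leX n : `|X - \int[leb]_(t in cell_itv [::]) fc (code n t)| <= e n.
  have mI := measurable_cell_itv [::].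
  have muI : (leb (cell_itv [::]) < +oo)%E by rewrite leb0 ltry.
  have int1 : leb.-integrable (cell_itv [::])
      (EFin \o (f \o representing_point)).
    by apply: (@bounded_integrable _ _ _ _ _ C) => //; exact: measurable_funTS.
  have int2 : leb.-integrable (cell_itv [::]) (EFin \o (fun t => fc (code n t))).
    apply: (@bounded_integrable _ _ _ _ _ C) => //.
    by apply: measurable_funTS; exact: measurable_code.
  have int12 : leb.-integrable (cell_itv [::])
      (EFin \o (fun t => f (representing_point t) - fc (code n t))).
    apply: (@bounded_integrable _ _ _ _ _ (C + C)) => [//|//||t _].
      apply: measurable_funB; first exact: measurable_funTS.
      by apply: measurable_funTS; exact: measurable_code.
    by rewrite (le_trans (ler_normB _ _))// lerD// fpC.
  rewrite /X -RintegralB//.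
  apply: (le_trans (le_normr_Rintegral mI int12)).
  have -> : e n =
      \int[leb]_(t in cell_itv [::]) (K * (rad n false + rad n true)).
    by rewrite Rintegral_cst//= [X in fine X]leb0.
  apply: le_Rintegral => //.
  - exact: (integrable_norm int12).
  - exact: (@bounded_integrable _ _ _ _ _ `|K * (rad n false + rad n true)|).
  move=> t _ /=; rewrite (le_trans (lipf _ _ _ _))//.
  - exact: box_representing_point.
  - by split; exact: centre_le.
  by rewrite ler_wpM2l// lerD// limit_point_code.
have e0 : 2 * e k.*2 @[k --> \oo] --> 2 * (K * (0 + 0) * weight [::]).
  apply: cvgMr; apply: cvgMl; apply: cvgMr; apply: cvgD; exact: cvg_rad_double.
rewrite addr0 mulr0 mul0r mulr0 in e0.
apply/eqP; rewrite -subr_eq0 -normr_le0; apply: (cvgr_to_ge e0); near=> k.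
rewrite mulr_natl mulr2n.
apply: (le_trans (ler_distD (\int[leb]_(t in cell_itv [::]) fc (code k.*2 t)) _ _)).
by rewrite lerD// distrC.
Unshelve. all: by end_near. Qed.

End BoundedRepresentation.

(** * Moment forms and polynomials *)

Section MapPoly2.
Context {F G : comNzRingType} (f : {rmorphism F -> G}).
Local Notation map2 := (map_poly (map_poly f)).

Lemma map2_polyC c : map2 c%:P%:P = (f c)%:P%:P.
Proof. by rewrite !map_polyC /= map_polyC. Qed.

Lemma map2_monomial_poly m n : map2 (monomial_poly m n) = monomial_poly m n.
Proof. by rewrite /monomial_poly rmorphM /= map_polyXn map_polyC /= map_polyXn. Qed.

End MapPoly2.

Section MomentForm.
Context {R : realType}.
Local Notation C := R[i].
Implicit Types (alpha s : nat -> nat -> C) (P : {poly {poly C}}).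

Definition conj_poly P : {poly {poly C}} := map_poly (map_poly conjc) P.

Definition coef2 P (m n : nat) : C := P`_n`_m.

Lemma coef2_finite P : finitely_supported2 (coef2 P).
Proof.
pose M := \max_(n < size P) size (P`_n)%R.
apply: (@sub_finite_set _ _ (`I_M `*` `I_(size P))); last exact: finite_setX.
move=> [m n] /= nz; split; rewrite /= ltnNge; apply: contra nz => le.
  rewrite /coef2; have [Pn|Pn] := ltnP n (size P); last first.
    by rewrite (nth_default _ Pn) coef0.
  rewrite nth_default//; apply: (leq_trans _ le).
  exact: (@leq_bigmax _ (fun n : 'I_(size P) => size P`_n) (Ordinal Pn)).
by rewrite /coef2 (nth_default _ le) coef0.
Qed.

Lemma finitely_supported2_coef alpha :
  finitely_supported2 alpha -> exists P, alpha = coef2 P.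
Proof.
move=> /finite_seqP[r Er].
pose N := (\max_(p <- r) maxn p.1 p.2).+1.
have aN m n : alpha m n != 0 -> (m < N)%N && (n < N)%N.
  move=> nz; have : (m, n) \in [set` r] by rewrite -Er inE.
  rewrite inE /= => mnr; rewrite !ltnS.
  have := @leq_bigmax_seq _ r xpredT (fun p => maxn p.1 p.2) _ mnr isT.
  by rewrite geq_max.
exists (\poly_(n < N) \poly_(m < N) alpha m n).
apply/funext => m; apply/funext => n; rewrite /coef2 coef_poly.
have [nN|nN] := ltnP n N; last first.
  by rewrite coef0; apply/eqP; apply: contraTT nN => /aN /andP[_]; rewrite -ltnNge.
rewrite coef_poly; have [//|mN] := ltnP m N.
by apply/eqP; apply: contraTT mN => /aN /andP[+ _]; rewrite -ltnNge.
Qed.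

Lemma poly2_expansion {F : comNzRingType} (P : {poly {poly F}}) N :
  (size P <= N)%N -> (forall n, (size (P`_n)%R <= N)%N) ->
  P = \sum_(i : 'I_N * 'I_N) (P`_i.2`_i.1)%:P%:P * monomial_poly i.1 i.2.
Proof.
move=> PN PnN; rewrite -(pair_bigA _ (fun m n : 'I_N =>
  (P`_n`_m)%:P%:P * monomial_poly m n)) exchange_big /=.
have trunc (A : nzRingType) (q : {poly A}) :
    (size q <= N)%N -> q = \sum_(i < N) (q`_i)%:P * 'X^i.
  move=> qN; rewrite -{1}[q]coefK poly_def (big_ord_widen N (fun i => q`_i *: 'X^i))//.
  rewrite [RHS](bigID (fun n : 'I_N => (n < size q)%N))/= [X in _ + X]big1 ?addr0.
    by apply: eq_bigr => i _; rewrite mul_polyC.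
  by move=> n; rewrite -leqNgt => pn; rewrite nth_default// mul0r.
rewrite {1}(trunc _ P PN); apply: eq_bigr => n _.
rewrite {1}(trunc _ P`_n (PnN n)) raddf_sum mulr_suml; apply: eq_bigr => m _.
by rewrite /= polyCM mulrA.
Qed.

(** The quadruple sum is the expansion of the functional at P times its conjugate. The variables
    stand for real numbers, so conjugation acts on coefficients only. *)
Lemma moment_form_coef2 P s :
  moment_form (coef2 P) s = moment_functional s (P * conj_poly P).
Proof.
pose N := maxn (size P) (\max_(n < size P) size (P`_n)%R).
have PN : (size P <= N)%N by rewrite leq_maxl.
have PnN n : (size (P`_n)%R <= N)%N.
  have [Pn|Pn] := ltnP n (size P); last by rewrite nth_default// size_poly0.
  apply: (leq_trans _ (leq_maxr _ _)).
  exact: (@leq_bigmax _ (fun n : 'I_(size P) => size P`_n) (Ordinal Pn)).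
have coefN m n : coef2 P m n != 0 -> (m < N)%N && (n < N)%N.
  rewrite /coef2 => nz; apply/andP; split; rewrite ltnNge.
    by apply: contra nz => le; rewrite nth_default// (leq_trans (PnN n)).
  apply: contra nz => le; rewrite (@nth_default _ _ P n) ?coef0//.
  exact: leq_trans le.
have EP := poly2_expansion P N PN PnN.
have Ec : conj_poly P = \sum_(i : 'I_N * 'I_N)
    ((P`_i.2`_i.1)^*)%:P%:P * monomial_poly i.1 i.2.
  rewrite {1}EP /conj_poly rmorph_sum; apply: eq_bigr => i _ /=.
  by rewrite rmorphM /= map2_monomial_poly map2_polyC.
rewrite Ec; set Q := (X in P * X); rewrite [X in X * Q]EP {}/Q mulr_suml.
rewrite (linear_form_sum _ _ _ _ _ (linear_moment_functional s)).
pose idx (i : ('I_N * 'I_N) * ('I_N * 'I_N)) : nat * nat * nat * nat :=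
  (i.1.1 : nat, i.1.2 : nat, i.2.1 : nat, i.2.2 : nat).
have idx_inj : injective idx.
  move=> [[a b] [c d]] [[a' b'] [c' d']] [] /= *.
  by congr ((_, _), (_, _)); exact: val_inj.
rewrite /moment_form (fsbigE [seq idx i | i : ('I_N * 'I_N) * ('I_N * 'I_N)])//.
- under eq_bigl do rewrite in_setT.
  rewrite big_map big_enum /=.
  rewrite -(pair_bigA _ (fun i j : 'I_N * 'I_N => coef2 P i.1 i.2 * (coef2 P j.1 j.2)^* *
    s (i.1 + j.1)%N (i.2 + j.2)%N)) /=.
  apply: eq_bigr => i _; rewrite mulr_sumr.
  rewrite (linear_form_sum _ _ _ _ _ (linear_moment_functional s)).
  apply: eq_bigr => j _; rewrite mulrACA -!polyCM monomial_polyM.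
  by rewrite (linear_formZ _ _ _ (linear_moment_functional s))
    moment_functional_monomial.
- by rewrite map_inj_uniq ?enum_uniq.
(* A quadruple outside the image of [idx] has an index beyond the range, so one of its two
   coefficients vanishes. *)
- move=> [[[m n] k] l] _ nin; apply/eqP; apply: contraNT nin.
  rewrite !mulf_eq0 !negb_or => /andP[/andP[/coefN/andP[mN nN] kl] _].
  have /coefN/andP[kN lN] : coef2 P k l != 0.
    by apply: contraNneq kl => ->; rewrite rmorph0.
  apply/mapP; exists ((Ordinal mN, Ordinal nN), (Ordinal kN, Ordinal lN)) => //.
  exact: mem_enum.
Qed.

Lemma re_im_poly P : exists a b : {poly {poly R}},
  P = map_poly (map_poly (real_complex R)) a +
      ('i%C : C)%:P%:P * map_poly (map_poly (real_complex R)) b.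
Proof.
move: P; apply: poly2_ind => [|c P Q [a [b ->]] [a' [b' ->]]|m n].
- by exists 0, 0; rewrite !rmorph0 mulr0 addr0.
- exists ((complex.Re c)%:P%:P * a - (complex.Im c)%:P%:P * b + a'),
    ((complex.Re c)%:P%:P * b + (complex.Im c)%:P%:P * a + b').
  rewrite !(rmorphD, rmorphN, rmorphM) /= !map2_polyC.
  set ta := map_poly _ a; set tb := map_poly _ b.
  set ta' := map_poly _ a'; set tb' := map_poly _ b'.
  rewrite {1}[c]complexE !polyCD !polyCM.
  have i2 : ('i%C : C)%:P%:P * ('i%C : C)%:P%:P = - 1 :> {poly {poly C}}.
    by rewrite -!polyCM -expr2 sqr_i !polyCN !polyC1.
  have E (S : comNzRingType) (re im i x y x' y' : S) : i * i = - 1 ->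
      (re + i * im) * (x + i * y) + (x' + i * y') =
      re * x - im * y + x' + i * (re * y + im * x + y').
    move=> ii; have -> : (re + i * im) * (x + i * y) =
      re * x + i * i * (im * y) + i * (re * y + im * x) by ring.
    by rewrite ii; ring.
  exact: E.
- exists (monomial_poly m n), 0; rewrite rmorph0 mulr0 addr0.
  by rewrite map2_monomial_poly.
Qed.

Lemma map2_poly_real (a : {poly {poly R}}) :
  conj_poly (map_poly (map_poly (real_complex R)) a) =
  map_poly (map_poly (real_complex R)) a.
Proof.
apply/polyP => n; apply/polyP => m; rewrite /conj_poly !coef_map /=.
by rewrite oppr0.
Qed.

Lemma conj_poly_norm (a b : {poly {poly R}}) :
  let P := map_poly (map_poly (real_complex R)) a +
      ('i%C : C)%:P%:P * map_poly (map_poly (real_complex R)) b in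
  P * conj_poly P = map_poly (map_poly (real_complex R)) (a ^+ 2 + b ^+ 2).
Proof.
rewrite /= /conj_poly rmorphD rmorphM /= -/(conj_poly _) map2_poly_real.
rewrite -/(conj_poly (map_poly _ b)) map2_poly_real map2_polyC /=.
have -> : Complex 0 (- 1) = - 'i%C :> C.
  by apply/eqP; rewrite eq_complex /= oppr0 !eqxx.
rewrite rmorphD !rmorphXn /= !polyCN.
have i2 : ('i%C : C)%:P%:P * ('i%C : C)%:P%:P = - 1 :> {poly {poly C}}.
  by rewrite -!polyCM -expr2 sqr_i !polyCN !polyC1.
have E (S : comNzRingType) (i x y : S) : i * i = - 1 ->
    (x + i * y) * (x + - i * y) = x ^+ 2 + y ^+ 2.
  move=> ii; have -> : (x + i * y) * (x + - i * y) = x ^+ 2 - i * i * y ^+ 2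
    by ring.
  by rewrite ii; ring.
exact: E.
Qed.

Lemma moment_functional_real (t : nat -> nat -> R) (p : {poly {poly R}}) :
  moment_functional (fun m n => (t m n)%:C) (map_poly (map_poly (real_complex R)) p)
  = (moment_functional t p)%:C.
Proof.
move: p; apply: poly2_ind => [|c p q Ep Eq|m n].
- rewrite rmorph0 !(linear_form0 _ (linear_moment_functional _)).
  by rewrite (rmorph0 (real_complex R)).
- rewrite rmorphD rmorphM /= map2_polyC !(linear_moment_functional _) Ep Eq.
  by rewrite (rmorphD (real_complex R)) (rmorphM (real_complex R)).
- by rewrite map2_monomial_poly !moment_functional_monomial.
Qed.

(** Multiplying a monomial by x2^2 shifts its second index by 2; linearity does the rest. This
    identifies the second condition with positivity on the multiples of r^2 - x2^2 by squares. *)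
Lemma strip_moment_functional {F : comNzRingType} (t : nat -> nat -> F) (c : F) p :
  moment_functional (fun m n => c ^+ 2 * t m n - t m (n + 2)%N) p =
  moment_functional t ((c%:P%:P ^+ 2 - 'X ^+ 2) * p).
Proof.
have lt := linear_moment_functional t.
move: p; apply: linear_form_eq => [|a p q|m n].
- exact: linear_moment_functional.
- by rewrite mulrDr mulrCA lt.
have -> : (c%:P%:P ^+ 2 - 'X ^+ 2) * monomial_poly m n =
    (c ^+ 2)%:P%:P * monomial_poly m n + ((- 1)%:P%:P * monomial_poly m (n + 2) + 0).
  rewrite mulrBl !polyC_exp addr0 !polyCN !polyC1 mulN1r; congr (_ - _).
  by rewrite /monomial_poly mulrCA -exprD addnC.
rewrite !lt (linear_form0 _ lt) !moment_functional_monomial addr0 mulN1r.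
by [].
Qed.


End MomentForm.

(** Write a complex polynomial as a + ib with a and b real: its product with its conjugate is a^2 +
    b^2, so real squares decide the complex condition. *)
Lemma moment_form_ge0P {R : realType} (t : nat -> nat -> R) :
  (forall alpha, finitely_supported2 alpha ->
    0 <= moment_form alpha (fun m n => (t m n)%:C)) <->
  (forall q, 0 <= moment_functional t (q ^+ 2)).
Proof.
split=> [pos q|pos alpha /finitely_supported2_coef[P ->]].
  have := pos _ (coef2_finite (map_poly (map_poly (real_complex R)) q)).
  rewrite moment_form_coef2 map2_poly_real -expr2 -rmorphXn /=.
  by rewrite moment_functional_real lecR.
have [a [b ->]] := re_im_poly P.
rewrite moment_form_coef2 conj_poly_norm moment_functional_real lecR.
rewrite (linear_formD _ _ _ (linear_moment_functional t)).
by rewrite addr_ge0.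
Qed.

(** Squares of monomials show that the moments with even indices are real. The square of 1 + x1^m
    x2^n then has the real value s(0,0) + 2 s(m,n) + s(2m,2n), which leaves s(m,n) real. *)
Lemma moments_real {R : realType} (s : nat -> nat -> R[i]) :
  (forall alpha, finitely_supported2 alpha -> 0 <= moment_form alpha s) ->
  s = fun m n => (complex.Re (s m n))%:C.
Proof.
move=> pos; have ls := linear_moment_functional s.
have lsD := linear_formD _ _ _ ls.
have sq p : 0 <= moment_functional s
    (map_poly (map_poly (real_complex R)) p *
     map_poly (map_poly (real_complex R)) p).
  rewrite -[X in _ * X]map2_poly_real -moment_form_coef2.
  exact/pos/coef2_finite.
have Im0 z : 0 <= z :> R[i] -> complex.Im z = 0.
  by rewrite lecE => /andP[/eqP].
have even m n : complex.Im (s (m + m)%N (n + n)%N) = 0.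
  apply: Im0; have := sq (monomial_poly m n).
  by rewrite map2_monomial_poly monomial_polyM moment_functional_monomial.
apply/funext => m; apply/funext => n.
have := sq (monomial_poly 0 0 + monomial_poly m n).
rewrite rmorphD /= !map2_monomial_poly mulrDl !mulrDr !monomial_polyM.
rewrite !lsD !moment_functional_monomial !addn0 !add0n => /Im0.
rewrite !raddfD /= even (even 0%N 0%N) add0r addr0 => /eqP.
rewrite -mulr2n mulrn_eq0 /= => /eqP smn0.
by apply/eqP; rewrite eq_complex /= smn0 !eqxx.
Qed.

(** * Measures on the strip *)

Section StripMeasure.
Context {R : realType} (r : R) (r0 : 0 < r).

Definition eval2 (p : {poly {poly R}}) (x : R * R) : R := p.[x.2%:P].[x.1].

Lemma eval2_lin c p q x : eval2 (c%:P%:P * p + q) x = c * eval2 p x + eval2 q x.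
Proof. by rewrite /eval2 !(hornerD, hornerM, hornerC). Qed.

Lemma eval2D p q x : eval2 (p + q) x = eval2 p x + eval2 q x.
Proof. by rewrite /eval2 !hornerD. Qed.

Lemma eval2M p q x : eval2 (p * q) x = eval2 p x * eval2 q x.
Proof. by rewrite /eval2 !hornerM. Qed.

Lemma eval2C c x : eval2 c%:P%:P x = c.
Proof. by rewrite /eval2 !hornerC. Qed.

Lemma eval2_monomial m n x : eval2 (monomial_poly m n) x = monomial2 m n x.
Proof.
by rewrite /eval2 /monomial_poly /monomial2 hornerM hornerC !hornerXn
  hornerM -polyC_exp hornerC hornerXn.
Qed.

Lemma expr_lipschitz (a : R) n : 0 <= a -> exists2 K, 0 <= K &
  forall x y : R, `|x| <= a -> `|y| <= a -> `|x ^+ n - y ^+ n| <= K * `|x - y|.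
Proof.
move=> a0; elim: n => [|n [K K0 lipK]].
  by exists 0 => // x y _ _; rewrite !expr0 subrr normr0 mul0r.
exists (a * K + a ^+ n) => [|x y xa ya]; first by rewrite addr_ge0 ?mulr_ge0 ?exprn_ge0.
have -> : x ^+ n.+1 - y ^+ n.+1 = x * (x ^+ n - y ^+ n) + (x - y) * y ^+ n.
  by rewrite !exprS; ring.
rewrite (le_trans (ler_normD _ _))// [leRHS]mulrDl lerD// normrM.
  by rewrite -mulrA ler_pM// lipK.
by rewrite mulrC ler_wpM2r// normrX lerXn2r// nnegrE.
Qed.

Lemma monomial2_lipschitz (a b : R) m n : 0 <= a -> 0 <= b ->
  exists2 K, 0 <= K & forall p q : R * R,
    `|p.1| <= a /\ `|p.2| <= b -> `|q.1| <= a /\ `|q.2| <= b ->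
    `|monomial2 m n p - monomial2 m n q| <= K * (`|p.1 - q.1| + `|p.2 - q.2|).
Proof.
move=> a0 b0.
have [K K0 lipK] := expr_lipschitz a m a0.
have [L L0 lipL] := expr_lipschitz b n b0.
exists (a ^+ m * L + K * b ^+ n) => [|p q [p1 p2] [q1 q2]].
  by rewrite addr_ge0// mulr_ge0// exprn_ge0.
have -> : monomial2 m n p - monomial2 m n q =
    p.1 ^+ m * (p.2 ^+ n - q.2 ^+ n) + (p.1 ^+ m - q.1 ^+ m) * q.2 ^+ n.
  by rewrite /monomial2; ring.
have am0 : 0 <= a ^+ m by rewrite exprn_ge0.
have bn0 : 0 <= b ^+ n by rewrite exprn_ge0.
have pm : `|p.1 ^+ m| <= a ^+ m by rewrite normrX lerXn2r// nnegrE.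
have qn : `|q.2 ^+ n| <= b ^+ n by rewrite normrX lerXn2r// nnegrE.
rewrite (le_trans (ler_normD _ _))// !normrM.
have H1 : `|p.1 ^+ m| * `|p.2 ^+ n - q.2 ^+ n| <= a ^+ m * (L * `|p.2 - q.2|).
  by rewrite ler_pM// lipL.
have H2 : `|p.1 ^+ m - q.1 ^+ m| * `|q.2 ^+ n| <= K * `|p.1 - q.1| * b ^+ n.
  by rewrite ler_pM// lipK.
rewrite (le_trans (lerD H1 H2))// -subr_ge0.
set d1 := `|p.1 - q.1|; set d2 := `|p.2 - q.2|.
have -> : (a ^+ m * L + K * b ^+ n) * (d1 + d2) -
  (a ^+ m * (L * d2) + K * d1 * b ^+ n) = a ^+ m * L * d1 + K * b ^+ n * d2 by ring.
by rewrite addr_ge0 ?mulr_ge0 ?normr_ge0.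
Qed.

Lemma measurable_strip : measurable (strip r).
Proof.
rewrite (_ : strip r = (fun x : R * R => `|x.2|) @^-1` `]-oo, r]%classic); last first.
  by apply/seteqP; split => x /=; rewrite in_itv.
rewrite -[X in measurable X]setTI.
have : measurable_fun [set: R * R] (fun x : R * R => `|x.2|).
  apply: measurableT_comp; [exact: normr_measurable|exact: measurable_snd].
by apply => //; exact: measurable_itv.
Qed.

Lemma measurable_monomial2 m n : measurable_fun [set: R * R] (monomial2 m n).
Proof.
by apply: measurable_funM; apply: measurable_funX;
  [exact: measurable_fst|exact: measurable_snd].
Qed.

Context (L : {poly {poly R}} -> R) (linL : linear_form L)
  (Lsqr : forall q, 0 <= L (q ^+ 2))
  (Lstrip : forall q, 0 <= L ((r%:P%:P ^+ 2 - 'X ^+ 2) * q ^+ 2)).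

Definition poly_dominated (f : R * R -> R) :=
  exists p, forall x, strip r x -> `|f x| <= eval2 p x.

(** Riesz's theorem for the cone of functions nonnegative on the strip, with [strip_form_ge0] as the
    positivity of the initial graph. That [L p] depends only on the function [eval2 p] comes from
    positivity too. *)
Lemma strip_extension : exists Lam : (R * R -> R) -> R,
  [/\ forall p, Lam (eval2 p) = L p,
      forall a f g, poly_dominated f -> poly_dominated g ->
        Lam (fun x => a * f x + g x) = a * Lam f + Lam g &
      forall f, poly_dominated f -> (forall x, strip r x -> 0 <= f x) ->
        0 <= Lam f].
Proof.
pose C (f : R * R -> R^o) := forall x, strip r x -> 0 <= f x.
pose G := range (fun p : {poly {poly R}} => (eval2 p : R * R -> R^o, L p)).
have C0 : C 0 by move=> x _.
have CD f g : C f -> C g -> C (f + g).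
  by move=> Cf Cg x sx; rewrite addr_ge0 ?Cf ?Cg.
have CZ (a : R) f : 0 <= a -> C f -> C (a *: f).
  by move=> a0 Cf x sx; rewrite mulr_ge0 ?Cf.
have posG : positive_graph C G.
  split=> [a _ _ [p _ <-] [q _ <-]|_ [p _ <-] /= Cp].
    exists (a%:P%:P * p + q) => //; congr pair; last exact: linL.
    by apply/funext => x; exact: eval2_lin.
  by apply: (strip_form_ge0 r r0 L) => // x y yr; exact: (Cp (x, y)).
have [|Lam [LamE Lamlin Lampos]] := riesz_extension C C0 CD CZ G posG.
  by exists (eval2 0, L 0), 0.
have domG f : poly_dominated f -> dominated_by C G f.
  move=> [p fp]; exists (eval2 p, L p); first by exists p.
  by split => x /fp; rewrite ler_norml => /andP[]; rewrite /= ?subr_ge0//;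
    move=> ? ?; rewrite -[X in _ <= _ + X]opprK subr_ge0 lerNl.
exists Lam; split.
- by move=> p; apply: (LamE (eval2 p, L p)); exists p.
- by move=> a f g /domG df /domG dg; exact: (Lamlin a f g).
- by move=> f /domG df fpos; exact: Lampos.
Qed.

End StripMeasure.

(** * Cutting the strip into bounded pieces and summing their measures *)

Section Pieces.
Context {R : realType} (r : R) (r0 : 0 < r).
Context (Lam : (R * R -> R) -> R).
Hypothesis Lam_lin : forall a f g, poly_dominated r f -> poly_dominated r g ->
  Lam (fun x => a * f x + g x) = a * Lam f + Lam g.
Hypothesis Lam_ge0 : forall f, poly_dominated r f ->
  (forall x, strip r x -> 0 <= f x) -> 0 <= Lam f.

Lemma poly_dominated_eval2 p : poly_dominated r (eval2 p).
Proof.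
(* The absolute value of t is at most 1 + t^2, which is again polynomial. *)
exists (1 + p ^+ 2) => x _; rewrite eval2D expr2 eval2M -!polyC1 eval2C.
by rewrite ler_norml; nra.
Qed.

Lemma poly_dominated_le f g : poly_dominated r g ->
  (forall x, strip r x -> `|f x| <= `|g x|) -> poly_dominated r f.
Proof.
by move=> [p gp] fg; exists p => x sx; rewrite (le_trans (fg _ sx))// gp.
Qed.

Lemma poly_dominated_lin a f g : poly_dominated r f -> poly_dominated r g ->
  poly_dominated r (fun x => a * f x + g x).
Proof.
move=> [p fp] [q gq]; exists (`|a|%:P%:P * p + q) => x sx.
rewrite eval2_lin (le_trans (ler_normD _ _))// lerD ?gq// normrM.
by rewrite ler_wpM2l// fp.
Qed.

Lemma poly_dominatedM f g : poly_dominated r f -> poly_dominated r g ->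
  poly_dominated r (fun x => f x * g x).
Proof.
move=> [p fp] [q gq]; exists (p * q) => x sx.
by rewrite eval2M normrM ler_pM ?fp ?gq.
Qed.

Lemma poly_dominated_bounded f : fbounded f -> poly_dominated r f.
Proof. by move=> [c fc]; exists c%:P%:P => x _; rewrite eval2C. Qed.

Lemma Lam0 : Lam (fun=> 0) = 0.
Proof.
have d0 : poly_dominated r (fun=> 0) := poly_dominated_bounded _ (fbounded_cst 0).
have := Lam_lin (- 1) _ _ d0 d0.
by rewrite mulr0 addr0 mulN1r addNr.
Qed.

Lemma LamB f g : poly_dominated r f -> poly_dominated r g ->
  Lam (fun x => f x - g x) = Lam f - Lam g.
Proof.
move=> df dg; rewrite [RHS]addrC -mulN1r -Lam_lin//.
by congr Lam; apply/funext => x; rewrite mulN1r addrC.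
Qed.

Lemma Lam_le f g : poly_dominated r f -> poly_dominated r g ->
  (forall x, strip r x -> f x <= g x) -> Lam f <= Lam g.
Proof.
move=> df dg fg; rewrite -subr_ge0 -LamB//; apply: Lam_ge0 => [|x sx].
  have := poly_dominated_lin (- 1) _ _ df dg.
  by under eq_fun do rewrite mulN1r addrC.
by rewrite subr_ge0 fg.
Qed.

Definition piece (n : nat) (x : R * R) : R :=
  ((n%:R <= `|x.1| < n.+1%:R) && (`|x.2| <= r))%:R.

Lemma piece_bounded n g : fbounded g -> fbounded (fun x => piece n x * g x).
Proof.
move=> [c gc]; exists c => x; rewrite /piece; case: (_ && _).
  by rewrite mul1r.
by rewrite mul0r normr0 (le_trans _ (gc x)).
Qed.

Lemma piece_dominated n g :
  poly_dominated r g -> poly_dominated r (fun x => piece n x * g x).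
Proof.
move=> dg; apply: (poly_dominated_le _ _ dg) => x _; rewrite /piece.
by case: (_ && _); rewrite ?mul1r// mul0r normr0.
Qed.

Definition piece_form n (g : R * R -> R) : R := Lam (fun x => piece n x * g x).

Lemma piece_form_lin n a f g : fbounded f -> fbounded g ->
  piece_form n (fun x => a * f x + g x) = a * piece_form n f + piece_form n g.
Proof.
move=> bf bg; rewrite /piece_form -Lam_lin; last 2 first.
- exact/poly_dominated_bounded/piece_bounded.
- exact/poly_dominated_bounded/piece_bounded.
by congr Lam; apply/funext => x; ring.
Qed.

Lemma piece_form_ge0 n f : fbounded f -> (forall x, 0 <= f x) ->
  0 <= piece_form n f.
Proof.
move=> bf f0; apply: Lam_ge0 => [|x _]; last by rewrite mulr_ge0.
exact/poly_dominated_bounded/piece_bounded.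
Qed.

(** The indicator makes the coordinate bounded on the whole plane, as the representation requires;
    off the piece the value 0 is invisible to [piece_form n]. *)
Definition piece_coord n (i : bool) (x : R * R) : R :=
  piece n x * (if i then x.2 else x.1).

Definition piece_halfwidth (n : nat) (i : bool) : R := if i then r else n.+1%:R.

Lemma piece_halfwidth_ge0 n i : 0 <= piece_halfwidth n i.
Proof. by case: i => //=; exact: ltW. Qed.

Lemma piece_coord_le n i x : `|piece_coord n i x| <= piece_halfwidth n i.
Proof.
rewrite /piece_coord /piece /piece_halfwidth.
have [/andP[/andP[_ x1] x2]|_] := boolP (_ && _).
  by rewrite mul1r; case: i => //; exact: ltW.
by rewrite mul0r normr0; exact: (piece_halfwidth_ge0 n i).
Qed.

Definition piece_measure n : {measure set (R * R)%type -> \bar R} :=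
  representing_measure (piece_form n) (piece_coord n) (piece_halfwidth n)
    (piece_halfwidth_ge0 n).

Definition strip_measure : {measure set (R * R)%type -> \bar R} :=
  mseries piece_measure 0.

Lemma piece_box_strip n : box (piece_halfwidth n) `<=` strip r.
Proof. by move=> x []. Qed.

Lemma strip_measureC : strip_measure (~` strip r) = 0%E.
Proof.
rewrite /strip_measure /= /mseries eseries0// => n _ _.
have mbox : measurable (box (piece_halfwidth n)).
  have msub i (c : R) :
      measurable [set x : R * R | `|if i then x.2 else x.1| <= c].
    rewrite (_ : mkset _ = (fun x : R * R => `|if i then x.2 else x.1|) @^-1`
      `]-oo, c]%classic); last first.
      by apply/seteqP; split => x /=; rewrite in_itv.
    rewrite -[X in measurable X]setTI.
    have : measurable_fun [set: R * R] (fun x => `|if i then x.2 else x.1|).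
      apply: measurableT_comp; first exact: normr_measurable.
      by case: i; [exact: measurable_snd|exact: measurable_fst].
    by apply => //; exact: measurable_itv.
  exact: measurableI (msub false _) (msub true _).
apply/eqP; rewrite eq_le measure_ge0 andbT.
rewrite -(representing_measure_box (piece_form n) (piece_coord n)
  (piece_halfwidth n) (piece_halfwidth_ge0 n)).
apply: le_measure; rewrite ?inE.
- exact: measurableC (measurable_strip r).
- exact: measurableC.
- by apply: subsetC; exact: piece_box_strip.
Qed.

Definition box_lipschitz (g : R * R -> R) := forall a, 0 <= a ->
  exists2 K, 0 <= K & forall p q : R * R,
    `|p.1| <= a /\ `|p.2| <= r -> `|q.1| <= a /\ `|q.2| <= r ->
    `|g p - g q| <= K * (`|p.1 - q.1| + `|p.2 - q.2|).

Lemma integral_piece_measure n g :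
  measurable_fun setT g -> box_lipschitz g ->
  (piece_measure n).-integrable (strip r) (EFin \o g) /\
  \int[piece_measure n]_(x in strip r) g x = Lam (fun x => piece n x * g x).
Proof.
move=> mg lipg; have [K K0 lipK] := lipg n.+1%:R (ler0n _ _).
have [ig ->] := integral_representing_measure (piece_form n) (piece_form_lin n)
  (piece_form_ge0 n) (piece_coord n) (piece_halfwidth n)
  (piece_halfwidth_ge0 n) (piece_coord_le n) (strip r) g K K0
  (measurable_strip r) mg (piece_box_strip n) lipK.
split; first exact: ig.
congr Lam; apply/funext => x; rewrite /piece_coord /piece.
by case: (_ && _); rewrite ?mul0r// !mul1r; case: x.
Qed.

Lemma sum_piece N x : strip r x -> \sum_(n < N) piece n x = (`|x.1| < N%:R)%R%:R.
Proof.
rewrite /strip /= => xr; elim: N => [|N IH].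
  by rewrite big_ord0 ltNge normr_ge0.
rewrite big_ord_recr /= IH /piece xr andbT.
have NS : N%:R < N.+1%:R :> R by rewrite ltr_nat.
have [xN|Nx] /= := ltP `|x.1| N%:R; last by rewrite add0r.
by rewrite (lt_trans xN NS) addr0.
Qed.

Lemma Lam_sum_piece N g : poly_dominated r g ->
  poly_dominated r (fun x => (\sum_(n < N) piece n x) * g x) /\
  Lam (fun x => (\sum_(n < N) piece n x) * g x) =
  \sum_(n < N) Lam (fun x => piece n x * g x).
Proof.
move=> dg; elim: N => [|N [dS IH]].
  rewrite big_ord0 -[in RHS]Lam0; split; last first.
    by congr Lam; apply/funext => x; rewrite big_ord0 mul0r.
  apply: (poly_dominated_le _ _ dg) => x _.
  by rewrite big_ord0 mul0r normr0.
have Ef : (fun x => (\sum_(n < N.+1) piece n x) * g x) =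
    (fun x => 1 * (piece N x * g x) + (\sum_(n < N) piece n x) * g x).
  by apply/funext => x; rewrite big_ord_recr /=; ring.
rewrite Ef big_ord_recr /= -IH; split.
  by apply: poly_dominated_lin => //; exact: piece_dominated.
rewrite Lam_lin//; last exact: piece_dominated.
by rewrite mul1r addrC.
Qed.

(** No mass escapes to infinity: where |x1| >= N + 1, g is at most (1 + x1^2) g / (N + 1), and the
    function (1 + x1^2) g is still dominated by a polynomial. The remainder is therefore at most M /
    (N + 1). *)
Lemma Lam_series_piece g : poly_dominated r g ->
  (forall x, strip r x -> 0 <= g x) ->
  \sum_(n < N) Lam (fun x => piece n x * g x) @[N --> \oo] --> Lam g.
Proof.
move=> dg g0; pose q : {poly {poly R}} := 1 + monomial_poly 2 0.
have qE x : eval2 q x = 1 + x.1 ^+ 2.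
  by rewrite eval2D -!polyC1 eval2C eval2_monomial /monomial2 expr0 mulr1.
have dqg : poly_dominated r (fun x => eval2 q x * g x).
  by apply: poly_dominatedM => //; exact: poly_dominated_eval2.
pose M := Lam (fun x => eval2 q x * g x).
rewrite -cvg_shiftS; apply/cvgrPdist_le => e e0.
have cv : harmonic n * M @[n --> \oo] --> (0 : R).
  by rewrite -[X in _ --> X](mul0r M); apply: cvgMl; exact: cvg_harmonic.
near=> N.
have [dS ES] := Lam_sum_piece N.+1 g dg; rewrite /= -ES -LamB// ger0_norm; last first.
  rewrite LamB// subr_ge0; apply: Lam_le => // x sx.
  by rewrite sum_piece// ler_piMl ?g0// lern1 leq_b1.
apply: (@le_trans _ _ (harmonic N * M)).
  have dh : poly_dominated r (fun x => harmonic N * (eval2 q x * g x) + 0).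
    by apply: poly_dominated_lin => //; exact/poly_dominated_bounded/fbounded_cst.
  have -> : harmonic N * M = Lam (fun x => harmonic N * (eval2 q x * g x) + 0).
    rewrite Lam_lin ?Lam0 ?addr0//.
    exact/poly_dominated_bounded/fbounded_cst.
  apply: Lam_le => // [|x sx].
    have := poly_dominated_lin (- 1) _ _ dS dg.
    by under eq_fun do rewrite mulN1r addrC.
  rewrite sum_piece// addr0 mulrA -[X in X - _]mul1r -mulrBl ler_wpM2r ?g0//.
  have [xN|Nx] := ltP `|x.1| N.+1%:R.
    by rewrite subrr qE mulr_ge0 ?harmonic_ge0// addr_ge0 ?sqr_ge0.
  rewrite subr0 /harmonic ler_pdivlMl// mulr1 qE (le_trans Nx)//.
  by rewrite -(real_normK (num_real x.1)); have := sqr_ge0 (`|x.1| - 1); nra.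
rewrite -[X in X <= _]ger0_norm.
  rewrite -[X in `|X|]subr0 distrC.
  by near: N; exact: (cvgrPdist_le _ _).1 cv _ e0.
apply: mulr_ge0; first exact: harmonic_ge0.
apply: Lam_ge0 => // x sx; rewrite mulr_ge0 ?g0// qE addr_ge0// sqr_ge0.
Unshelve. all: by end_near. Qed.

(** Nonnegativity lets the integral be taken piece by piece; the resulting series is summed by
    [Lam_series_piece]. *)
Lemma ge0_integral_strip_measure g : measurable_fun setT g -> box_lipschitz g ->
  poly_dominated r g -> (forall x, 0 <= g x) ->
  (\int[strip_measure]_(x in strip r) (g x)%:E)%E = (Lam g)%:E.
Proof.
move=> mg lipg dg g0.
rewrite (@ge0_integral_measure_series _ _ _ piece_measure _ (measurable_strip r));
  last 2 first.
- by move=> x _; rewrite lee_fin.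
- by apply/measurable_EFinP; exact: measurable_funTS.
transitivity (\sum_(n <oo) (Lam (fun x => piece n x * g x))%:E)%E.
  apply: eq_eseriesr => n _; have [ig <-] := integral_piece_measure n g mg lipg.
  by rewrite fineK//; exact: (integrable_fin_num (measurable_strip r) ig).
apply: cvg_lim => //.
under eq_fun do rewrite big_mkord sumEFin.
apply: cvg_EFin; first by near=> N.
exact: Lam_series_piece.
Unshelve. all: by end_near. Qed.

(* A monomial f is the difference of |f| + f and |f|, which are nonnegative and
   still Lipschitz on boxes. *)
Lemma strip_measure_monomial m n :
  strip_measure.-integrable (strip r) (fun x => (monomial2 m n x)%:E) /\
  \int[strip_measure]_(x in strip r) monomial2 m n x = Lam (monomial2 m n).
Proof.
set f := monomial2 m n.
have mf : measurable_fun setT f := measurable_monomial2 m n.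
have lipf : box_lipschitz f.
  by move=> a a0; exact: monomial2_lipschitz (ltW r0).
have df : poly_dominated r f.
  rewrite (_ : f = eval2 (monomial_poly m n)); first exact: poly_dominated_eval2.
  by apply/funext => x; rewrite eval2_monomial.
pose g x := `|f x|; pose k x := g x + f x.
have mg : measurable_fun setT g by exact: measurableT_comp.
have mk : measurable_fun setT k by exact: measurable_funD.
have lipg : box_lipschitz g.
  move=> a a0; have [K K0 lipK] := lipf a a0; exists K => // p q bp bq.
  exact: le_trans (ler_dist_dist _ _) (lipK _ _ bp bq).
have lipk : box_lipschitz k.
  move=> a a0; have [K K0 lipK] := lipf a a0; have [K' K'0 lipK'] := lipg a a0.
  exists (K' + K) => [|p q bp bq]; first exact: addr_ge0.
  rewrite /k opprD addrACA mulrDl (le_trans (ler_normD _ _))// lerD//.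
    exact: lipK'.
  exact: lipK.
have dg : poly_dominated r g.
  by apply: (poly_dominated_le _ _ df) => x _; rewrite /g normr_id.
have dk : poly_dominated r k.
  by have := poly_dominated_lin 1 _ _ dg df; under eq_fun do rewrite mul1r.
have g0 x : 0 <= g x by exact: normr_ge0.
have k0 x : 0 <= k x.
  by rewrite /k /g; have := ler_norm (- f x); rewrite normrN; lra.
have Ig := ge0_integral_strip_measure g mg lipg dg g0.
have Ik := ge0_integral_strip_measure k mk lipk dk k0.
have ge0_integrable (h : R * R -> R) : measurable_fun setT h -> (forall x, 0 <= h x) ->
    (\int[strip_measure]_(x in strip r) (h x)%:E)%E = (Lam h)%:E ->
    strip_measure.-integrable (strip r) (EFin \o h).
  move=> mh h0 Ih; apply/integrableP; split.
    by apply/measurable_EFinP; exact: measurable_funTS.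
  rewrite (eq_integral (fun x => (h x)%:E)) ?Ih ?ltry// => x _.
  by rewrite /= ger0_norm.
have ig := ge0_integrable g mg g0 Ig; have ik := ge0_integrable k mk k0 Ik.
have Ef : f = fun x => k x - g x by apply/funext => x; rewrite /k addrC addKr.
split.
  apply/integrableP; split; first by apply/measurable_EFinP; exact: measurable_funTS.
  by rewrite [X in (X < _)%E](_ : _ = (Lam g)%:E) ?ltry// -Ig.
rewrite [in LHS]Ef RintegralB//; last exact: measurable_strip.
by rewrite /Rintegral Ik Ig /= -LamB// -Ef.
Qed.

End Pieces.

(** * Integrals of polynomials, and the two implications *)

Lemma strip_moment_functional_integral (R : realType) (r : R)
    (mu : {measure set (R * R)%type -> \bar R}) (t : nat -> nat -> R) :
  (forall m n, mu.-integrable (strip r) (fun x => (monomial2 m n x)%:E) /\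
    \int[mu]_(x in strip r) monomial2 m n x = t m n) ->
  forall p, mu.-integrable (strip r) (EFin \o eval2 p) /\
    \int[mu]_(x in strip r) eval2 p x = moment_functional t p.
Proof.
move=> mom; have mD := measurable_strip r.
(* Integrability is carried through the induction because additivity of the integral relies on
   it. *)
apply: poly2_ind => [|c p q [ip Ip] [iq Iq]|m n].
- rewrite (_ : eval2 0 = fun=> 0); last first.
    by apply/funext => x; rewrite -!polyC0 eval2C.
  rewrite (linear_form0 _ (linear_moment_functional t)).
  rewrite Rintegral_cst ?mul0r; last exact: mD.
  split => //; exact: (integrable0 mu (strip r)).
- have icp : mu.-integrable (strip r) (EFin \o (fun x => c * eval2 p x)).
    have := integrableZl mD c ip.
    by apply: eq_integrable => // x _; rewrite /= EFinM.
  have Ef : eval2 (c%:P%:P * p + q) = fun x => c * eval2 p x + eval2 q x.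
    by apply/funext => x; exact: eval2_lin.
  rewrite linear_moment_functional Ef RintegralD// RintegralZl// Ip Iq.
  split => //; have := integrableD mD icp iq.
  by apply: eq_integrable => // x _; rewrite /= EFinD.
- have [im Im] := mom m n; rewrite moment_functional_monomial -Im.
  by rewrite (_ : eval2 _ = monomial2 m n)//; apply/funext => x; exact: eval2_monomial.
Qed.

Theorem theorem2p2 (R : realType) (r : R) (hr : 0 < r)
    (s : nat -> nat -> R[i]) :
  (exists mu : {measure set (R * R)%type -> \bar R},
      strip_moment_measure r s mu) <->
  (forall alpha : nat -> nat -> R[i], finitely_supported2 alpha ->
      0 <= moment_form alpha s /\
      0 <= moment_form alpha
             (fun m n : nat => (r ^+ 2)%:C * s m n - s m (n + 2)%N)).
Proof.
have shift (t : nat -> nat -> R) :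
    (fun m n => (r ^+ 2)%:C * (t m n)%:C - (t m (n + 2)%N)%:C) =
    (fun m n => (r ^+ 2 * t m n - t m (n + 2)%N)%:C).
  apply/funext => m; apply/funext => n.
  by rewrite -(rmorphM (real_complex R)) -(rmorphB (real_complex R)).
split=> [[mu [_ mom]]|pos].
  (* From measure to conditions: the two forms become integrals over the strip of q^2 and of (r^2 -
     x2^2) q^2, both nonnegative there. *)
  pose t m n := \int[mu]_(x in strip r) monomial2 m n x.
  have -> : s = fun m n => (t m n)%:C.
    by apply/funext => m; apply/funext => n; rewrite /t (mom m n).2.
  have int := strip_moment_functional_integral R r mu t
    (fun m n => conj (mom m n).1 erefl).
  rewrite shift => alpha fin; split; move: alpha fin; apply/moment_form_ge0P => q.
    by rewrite -(int _).2; apply: Rintegral_ge0 => x _; rewrite expr2 eval2M -expr2 sqr_ge0.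
  rewrite strip_moment_functional -(int _).2; apply: Rintegral_ge0 => x.
  rewrite /strip /= => xr.
  have -> : eval2 ((r%:P%:P ^+ 2 - 'X ^+ 2) * q ^+ 2) x =
      (r ^+ 2 - x.2 ^+ 2) * eval2 q x ^+ 2.
    by rewrite /eval2 !(hornerE, horner_exp).
  rewrite mulr_ge0 ?sqr_ge0// subr_ge0 -(real_normK (num_real x.2)).
  by rewrite lerXn2r ?nnegrE// ltW.
(* From conditions to measure: once the moments are known to be real, both conditions pass to the
   real functional of [t]. *)
have Es := moments_real s (fun alpha fin => (pos alpha fin).1).
set t := fun m n => complex.Re (s m n).
have {}Es : s = fun m n => (t m n)%:C := Es.
rewrite Es shift in pos *.
have Lsqr := (moment_form_ge0P t).1 (fun alpha fin => (pos alpha fin).1).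
have Lstrip := (moment_form_ge0P _).1 (fun alpha fin => (pos alpha fin).2).
have [|Lam [LamE Lam_lin Lam_ge0]] := strip_extension r hr _ (linear_moment_functional t) Lsqr.
  by move=> q; rewrite -strip_moment_functional; exact: Lstrip.
exists (strip_measure r hr Lam); split; first exact: strip_measureC.
move=> m n; have [im ->] := strip_measure_monomial r hr Lam Lam_lin Lam_ge0 m n.
split => //; rewrite -(moment_functional_monomial t) -LamE; congr (Lam _)%:C.
by apply/funext => x; rewrite eval2_monomial.
Qed.
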